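(* Let $\Delta=4$ and let $n$ be an integer with $t=n+4-4\Delta=n-12\geq 3$. Among all trees on $n$ vertices whose maximum degree $4$ is attained by exactly two vertices, the maximal energy tree has as many as possible $2$-branches; the tree with maximal energy is $T_b(4,t)$ if $t=4$, and $T_a(4,t)$ otherwise.
   Context: For a simple graph $G$, the energy $E(G)$ is the sum of the absolute values of the eigenvalues of the adjacency matrix of $G$. A $2$-branch is a pendent vertex attached to a vertex of degree two. $P_k$ denotes the path on $k$ vertices. For $\Delta\geq 3$, $t\geq 3$: $T_a(\Delta,t)$ is the tree obtained from a path $P_t$ by attaching $\Delta-1$ pendent paths $P_2$ (each joined by an edge from one of its end vertices) to each of the two end vertices of $P_t$; $T_b(\Delta,t)$ is the tree obtained from a path $w_1w_2\cdots w_{t+2}$ by attaching $\Delta-1$ pendent paths $P_2$ to $w_1$ and $\Delta-2$ pendent paths $P_2$ to $w_{t+1}$. Both have $t+4\Delta-4$ vertices and exactly two vertices of degree $\Delta$.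
   Formalization: In T_b the Δ−2 pendent P_2's are attached to w_2, not w_{t+1} (with w_{t+1} the claim fails at t=4); ''as many as possible 2-branches'' is taken among trees of the class whose only branching vertices are the two of degree 4, since over the whole class it fails at n=17. *)

(* Defs.v *)
From HB Require Import structures.
From mathcomp Require Import all_boot all_order all_algebra.
From mathcomp Require Import polyrcf reals.

Set Implicit Arguments.
Unset Strict Implicit.
Unset Printing Implicit Defensive.

Import Order.TTheory GRing.Theory Num.Theory.

Local Open Scope ring_scope.

Section Graphs.

Variables (V : finType) (e : rel V).

Definition simple_graph : Prop := symmetric e /\ irreflexive e.

(* [ucycle e c] also holds for the empty sequence and, in a simple graph, for
   the two end points of an edge; hence the bound 2 on the size. *)
Definition acyclic : Prop := forall c : seq V, ucycle e c -> (size c <= 2)%N.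

Definition tree : Prop :=
  [/\ simple_graph, (0 < #|V|)%N, (forall x y : V, connect e x y) & acyclic].

Definition degree (x : V) : nat := #|[set y | e x y]|.

Definition max_degree : nat := \max_(x : V) degree x.

Definition two_branch (x : V) : bool :=
  (degree x == 1%N) && [exists y, e x y && (degree y == 2%N)].

Definition num_two_branches : nat := #|[set x | two_branch x]|.

Definition adjacency (R : nzRingType) : 'M[R]_#|V| :=
  \matrix_(i, j) (e (enum_val i) (enum_val j))%:R.

(* Sum of the absolute values of the eigenvalues, counted with their
   multiplicity as roots of the characteristic polynomial. [rootsR] lists the
   distinct roots lying in [R]; no eigenvalue is lost, as the adjacency matrix
   of a simple graph is real symmetric. *)
Definition energy (R : realType) : R :=
  let p := char_poly (adjacency R) in
  \sum_(x <- rootsR p) `|x| *+ mup x p.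

(* The trees on n vertices whose maximum degree D is attained exactly twice. *)
Definition two_max_tree (n D : nat) : Prop :=
  [/\ tree, #|V| = n, max_degree = D & #|[set x | degree x == D]| = 2%N].

Definition branching_at_max_only : Prop :=
  forall x : V, (2 < degree x)%N -> degree x = max_degree.

End Graphs.

Definition graph_iso (V W : finType) (e : rel V) (f : rel W) : Prop :=
  exists2 h : V -> W, bijective h & forall x y : V, f (h x) (h y) = e x y.

Definition max_energy_tree (R : realType) (n D : nat) (V : finType) (e : rel V)
    : Prop :=
  two_max_tree e n D /\
  forall (W : finType) (f : rel W), two_max_tree f n D ->
    energy f R <= energy e R.

(* "As many as possible 2-branches" compares trees without branching vertices
   other than the two of degree D, as usual for this kind of statement. Over
   all of [two_max_tree] it would be wrong: for D = 4, attaching 3, 1 and 3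
   pendent P_2's to the successive vertices of P_3 gives a tree on 17 vertices
   with seven 2-branches, whereas T_a(4, 5) has six and a larger energy. *)
Definition most_two_branches (n D : nat) (V : finType) (e : rel V) : Prop :=
  branching_at_max_only e /\
  forall (W : finType) (f : rel W), two_max_tree f n D ->
    branching_at_max_only f -> (num_two_branches f <= num_two_branches e)%N.

(* Path on the vertices 0, ..., m - 1 with c i pendent P_2's attached to i. In
   the pendent P_2 with label p, [inr (p, false)] is the vertex joined to the
   path vertex [tag p] and [inr (p, true)] is the leaf. *)
Section PathWithP2.

Variables (m : nat) (c : nat -> nat).

Definition path_P2_vertex : finType :=
  ('I_m + {i : 'I_m & 'I_(c i)} * bool)%type.

Definition path_P2_arc (u v : path_P2_vertex) : bool :=
  match u, v with
  | inl i, inl j => (j == i.+1 :> nat)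
  | inl i, inr (p, false) => tag p == i
  | inr (p, false), inr (q, true) => p == q
  | _, _ => false
  end.

Definition path_P2 : rel path_P2_vertex :=
  fun u v => path_P2_arc u v || path_P2_arc v u.

End PathWithP2.

Arguments path_P2 : clear implicits.

Definition Ta (D t : nat) :=
  path_P2 t
    (fun i => if (i == 0%N) || (i == t.-1) then (D - 1)%N else 0%N).

(* T_b(D, t): on the path w_1 ... w_(t+2), D - 1 pendent P_2's are attached to
   the end w_1 and D - 2 to the vertex w_2 next to that end (w_i has index
   i - 1). Attaching the latter to w_(t+1) instead would leave only 2 D - 3
   2-branches, against 2 D - 2 in T_a(D, t), and give a tree which for
   D = t = 4 has a smaller energy than T_a(4, 4). *)
Definition Tb (D t : nat) :=
  path_P2 (t + 2)
    (fun i => if i == 0%N then (D - 1)%N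
              else if i == 1%N then (D - 2)%N else 0%N).

Arguments Ta : clear implicits.
Arguments Tb : clear implicits.

(* Main.v *)
(** The eigenvalues [a] of a tree with matching polynomial [M] satisfy
    [prod (1 + a^2 y) = M(y)^2], so by Coulson's integral formula the energy is
    monotone in [M], compared pointwise on [(0, oo)]. Replacing a branch by a path,
    inserting a side branch into the path between the two vertices of degree 4, and
    turning a pendent path into P_2 all increase [M]; when the two vertices are not
    adjacent this leads to T_a, and otherwise to T_b. The polynomials of T_a and T_b
    are not comparable: with [P_k] that of the path on [k] vertices, their difference
    is [2 y^3 (1 + y)^3 (y - 2) P_(t-3)]. Rational approximations of the eigenvalues
    settle [t <= 5]. For [t >= 6] the ratio of the two polynomials is bounded below by
    its value at [t = 7] for [y <= 2] and at [t = 6] for [y >= 2], which differ so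
    little below 2 that the gap between the energies at [t = 6] survives. *)

(* Uniqueness of the maximal tree is part of the claim, so every reduction records either that the
   trees agree or that the polynomial grows strictly. The type [rtree] is an encoding on which both
   can be followed: graphs realizing the same encoding are isomorphic. Grafting needs the pair
   [mpol], [mdel]: moving the root of a branch may raise [mdel] alone, which shows in [mpol] only
   after the next graft. Adjacent centres form a separate case for the following reason. Moving one
   vertex from a pendent P_3 into the spine changes the polynomial by a positive multiple of X_(c+1)
   - X_c, where X is the spine sequence. For adjacent centres the corresponding expression is (1 +
   y) X_0 - X_1, which for three P_2's equals X_0 y (y - 2) / (1 + y); this is the origin of the
   factor y - 2. The integral comparison is stated for arbitrary lists of nonnegative reals. Lists
   of rational approximations and concatenations of lists are therefore covered, and they carry the
   numerical bounds and the ratios of polynomials. *)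
Require Import Defs.
From mathcomp Require Import all_boot all_order all_algebra fingroup perm.
From mathcomp Require Import spectral complex polyrcf reals trigo.
From mathcomp Require boolp functions topology normedtype derive realfun exp.
From mathcomp Require Import zify ring lra.

Set Implicit Arguments.
Unset Strict Implicit.
Unset Printing Implicit Defensive.

Import Order.TTheory GRing.Theory Num.Theory.

(** * The truncated Coulson integral *)

Module CoulsonIntegral.

Import boolp functions topology normedtype derive realfun exp.
Import numFieldNormedType.Exports.
Local Open Scope ring_scope.

Section Calculus.
Variable R : realType.
Implicit Types (f df : R -> R) (a x y : R) (l : seq R).

Lemma derive_mvt f df a b : a < b ->
  (forall x, a <= x <= b -> is_derive x 1 f (df x)) ->
  exists2 c, a < c < b & f b - f a = df c * (b - a).
Proof.
move=> ab fd.
have [||c] := @MVT R f df a b ab.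
- by move=> x; rewrite in_itv/= => /andP[ax xb]; apply: fd; rewrite !ltW.
- apply: derivable_within_continuous => x; rewrite in_itv/= => axb.
  by have [] := fd x axb.
by rewrite in_itv/=; exists c.
Qed.

Lemma derive_nondecr f df a b : a <= b ->
  (forall x, a <= x <= b -> is_derive x 1 f (df x)) ->
  (forall x, a < x < b -> 0 <= df x) -> f a <= f b.
Proof.
rewrite le_eqVlt => /predU1P[->//|ab] fd df0.
have [c acb e] := derive_mvt ab fd.
by rewrite -subr_ge0 e mulr_ge0 ?df0// subr_ge0 ltW.
Qed.

Lemma derive_incr f df a b : a < b ->
  (forall x, a <= x <= b -> is_derive x 1 f (df x)) ->
  (forall x, a < x < b -> 0 < df x) -> f a < f b.
Proof.
move=> ab fd df0; have [c acb e] := derive_mvt ab fd.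
by rewrite -subr_gt0 e mulr_gt0 ?df0// subr_gt0.
Qed.

Lemma atan_ge0 x : 0 <= x -> 0 <= atan x.
Proof. by move=> x0; rewrite -(@atan0 R) le_atan. Qed.

Lemma atan_le_id x : 0 <= x -> atan x <= x.
Proof.
move=> x0.
have H : (fun z => z - atan z) 0 <= (fun z => z - atan z) x.
  apply: (@derive_nondecr _ (fun z => 1 - (1 + z ^+ 2)^-1) 0 x x0) => z _.
  by rewrite subr_ge0 invf_le1 ?lerDl ?sqr_ge0// ltr_pwDl// sqr_ge0.
by move: H; rewrite /= atan0 subr0 subr_ge0.
Qed.

Definition sqprod l y : R := \prod_(a <- l) (1 + a ^+ 2 * y).

(* An antiderivative of [ln (sqprod l (x^2)) / x^2] vanishing at 0; its limit at
   infinity is [pi] times the sum of [l], which is Coulson's integral formula. *)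
Definition coulson l x : R :=
  \sum_(a <- l) (2 * (a * atan (a * x)) - ln (1 + a ^+ 2 * x ^+ 2) / x).

Lemma sqterm_gt0 a y : 0 <= y -> 0 < 1 + a ^+ 2 * y.
Proof. by move=> y0; rewrite ltr_pwDl// mulr_ge0// sqr_ge0. Qed.

Lemma sqprod_gt0 l y : 0 <= y -> 0 < sqprod l y.
Proof. by move=> y0; rewrite prodr_gt0// => a _; apply: sqterm_gt0. Qed.

Lemma sqprod_cat l1 l2 y : sqprod (l1 ++ l2) y = sqprod l1 y * sqprod l2 y.
Proof. by rewrite /sqprod big_cat. Qed.

Lemma is_derive_coulson l x : 0 < x ->
  is_derive x 1 (coulson l) (ln (sqprod l (x ^+ 2)) / x ^+ 2).
Proof.
move=> x0; elim: l => [|a l IH].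
  rewrite /coulson /sqprod big_nil ln1 mul0r.
  under eq_fun do rewrite big_nil.
  exact: is_derive_cst.
rewrite /sqprod big_cons lnM ?posrE ?sqterm_gt0 ?sqprod_gt0 ?sqr_ge0//.
rewrite mulrDl.
have -> : coulson (a :: l) = ((fun x => 2 * (a * atan (a * x))
    - ln (1 + a ^+ 2 * x ^+ 2) * x^-1) : R -> R) + coulson l.
  by apply/funext => z; rewrite /coulson big_cons.
apply: is_deriveD.
have xn0 : x != 0 by rewrite gt_eqF.
have h0 : 0 < 1 + a ^+ 2 * x ^+ 2 by rewrite sqterm_gt0 ?sqr_ge0.
have dax : is_derive x 1 ( *%R a) a.
  by have := @is_deriveZ _ _ _ id a x 1 1 (is_derive_id _ _); rewrite /GRing.scale/= mulr1.
have d1 : is_derive x 1 (fun x => atan (a * x)) ((1 + (a * x) ^+ 2)^-1 * a).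
  exact: (is_derive1_comp (is_derive1_atan _) dax).
have d2 : is_derive x 1 (fun x => 2 * (a * atan (a * x)))
   (2 * (a * ((1 + (a * x) ^+ 2)^-1 * a))).
  by apply: (@is_deriveZ _ _ _ (fun x => a * atan (a * x)) 2);
     apply: (@is_deriveZ _ _ _ (fun x => atan (a * x)) a).
have d3 : is_derive x 1 (fun x : R => 1 + a ^+ 2 * x ^+ 2) (a ^+ 2 * (2 * x)).
  have d31 : is_derive x 1 (fun x : R => x ^+ 2) (2 * x).
    have -> : (fun x : R => x ^+ 2) = id * id :> (R -> R).
      by apply/funext => z; rewrite expr2.
    have /is_derive_eq := is_deriveM (is_derive_id x (1 : R)) (is_derive_id x 1).
    by apply; rewrite /GRing.scale /= mulr1 mulr2n mulrDl mul1r.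
  have /is_derive_eq := is_deriveD (is_derive_cst (1 : R) x (1 : R))
    (is_deriveZ (a ^+ 2) d31).
  by apply; rewrite add0r.
have d4 : is_derive x 1 (fun x : R => ln (1 + a ^+ 2 * x ^+ 2))
   ((1 + a ^+ 2 * x ^+ 2)^-1 * (a ^+ 2 * (2 * x))).
  exact: (@is_derive1_comp _ (@ln R) (fun x => 1 + a ^+ 2 * x ^+ 2) _ _ _
    (is_derive1_ln h0) d3).
have d5 : is_derive x 1 (fun x : R => x^-1) (- x ^- 2).
  have /is_derive_eq := is_deriveV xn0 (is_derive_id x 1).
  by apply; rewrite /GRing.scale /= mulr1.
have d6 := @is_deriveM _ _ _ _ x 1 _ _ d4 d5.
have := is_deriveB d2 d6.
move/is_derive_eq; apply; rewrite /GRing.scale /=.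
have h1 : 1 + (a * x) ^+ 2 != 0 by rewrite exprMn gt_eqF.
have h2 : 1 + a ^+ 2 * x ^+ 2 != 0 by rewrite gt_eqF.
by field; rewrite xn0 h1.
Qed.

End Calculus.

Section Coulson.
Variable R : realType.
Implicit Types (a x y : R) (l : seq R).

Lemma atan_ge_pihalf x : 0 < x -> pi / 2 - x^-1 <= atan x.
Proof.
move=> x0; rewrite lerBlDr; apply: (cvgr_to_le (@cvgy_atan R)).
near=> v; have xv : x < v by near: v; apply: nbhs_pinfty_gt; rewrite num_real.
have d z : x <= z <= v ->
    is_derive z 1 (- @atan R - GRing.inv) (- (1 + z ^+ 2)^-1 - - z ^- 2).
  move=> /andP[xz _]; have z0 : z != 0 by rewrite gt_eqF// (lt_le_trans x0).
  apply: is_deriveB; first exact: (is_deriveN (is_derive1_atan z)).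
  have /is_derive_eq := is_deriveV z0 (is_derive_id z 1).
  by apply; rewrite /GRing.scale /= mulr1.
have z20 z : x < z < v -> 0 <= - (1 + z ^+ 2)^-1 - - z ^- 2.
  move=> /andP[xz _]; have z0 : 0 < z by rewrite (lt_trans x0).
  have : (1 + z ^+ 2)^-1 <= z ^- 2.
    by rewrite lef_pV2 ?posrE ?ltr_pwDl ?exprn_gt0 ?sqr_ge0 ?lerDr.
  lra.
have := derive_nondecr (ltW xv) d z20.
rewrite -[X in X <= _]/(- atan x - x^-1) -[X in _ <= X]/(- atan v - v^-1).
have v0 : 0 < v^-1 by rewrite invr_gt0 (lt_trans x0).
move=> H; lra.
Unshelve. all: by end_near. Qed.

(** Stands in for the value at the lower endpoint 0, where the formula divides by x: both terms of
    each summand are O(x). *)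
Lemma coulson_small l x : all (Num.le 0) l -> 0 < x ->
  `|coulson l x| <= (\sum_(a <- l) 2 * a ^+ 2) * x.
Proof.
move=> l0 x0; rewrite /coulson mulr_suml.
apply: le_trans (ler_norm_sum _ _ _) _.
rewrite !big_seq; apply: ler_sum => a al.
have a0 : 0 <= a by exact: (allP l0).
have h1 := atan_ge0 (mulr_ge0 a0 (ltW x0)).
have h2 := atan_le_id (mulr_ge0 a0 (ltW x0)).
have h3 : 0 <= ln (1 + a ^+ 2 * x ^+ 2) / x.
  by rewrite divr_ge0 ?(ltW x0)// ln_ge0// lerDl mulr_ge0// sqr_ge0.
have h4 : ln (1 + a ^+ 2 * x ^+ 2) / x <= a ^+ 2 * x.
  rewrite ler_pdivrMr// (_ : _ * x * x = a ^+ 2 * x ^+ 2); last by ring.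
  rewrite le_ln1Dx// (lt_le_trans (ltrN10 _))//.
  by rewrite mulr_ge0 ?sqr_ge0.
have h5 : 0 <= a * atan (a * x) by rewrite mulr_ge0.
have h6 : a * atan (a * x) <= a * (a * x) by rewrite ler_wpM2l.
have h7 : 0 <= a * (a * x) by rewrite !mulr_ge0// ltW.
by rewrite ler_norml; apply/andP; split; nra.
Qed.

Lemma coulson_le_pi l x : all (Num.le 0) l -> 0 < x ->
  coulson l x <= pi * \sum_(a <- l) a.
Proof.
move=> l0 x0; rewrite /coulson mulr_sumr !big_seq; apply: ler_sum => a al.
have a0 : 0 <= a by exact: (allP l0).
have h3 : 0 <= ln (1 + a ^+ 2 * x ^+ 2) / x.
  by rewrite divr_ge0 ?(ltW x0)// ln_ge0// lerDl mulr_ge0// sqr_ge0.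
have h := ltW (atan_ltpi2 (a * x)).
have h6 : a * atan (a * x) <= a * (pi / 2) by rewrite ler_wpM2l.
lra.
Qed.

(** At x = s^2 the argument of the logarithm is at most the fourth power of 1 + (a + 1) s, so the
    logarithm is at most 4 (a + 1) s and the term is O(1 / s) after division by s^2. *)
Lemma pi_le_coulson l s : all (Num.le 0) l -> 1 <= s ->
  pi * \sum_(a <- l) a <= coulson l (s ^+ 2) + (\sum_(a <- l) (2 + 4 * (a + 1))) / s.
Proof.
move=> l0 s1; rewrite /coulson mulr_sumr mulr_suml -big_split/= !big_seq.
have s0 : 0 < s by rewrite (lt_le_trans ltr01).
apply: ler_sum => a al; have : 0 <= a by exact: (allP l0).
have sV0 : 0 < s^-1 by rewrite invr_gt0.
have s20 : 0 < s ^+ 2 by rewrite exprn_gt0.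
rewrite le_eqVlt => /predU1P[<-|a0].
  rewrite expr0n /= !mul0r !mulr0 addr0 ln1 mul0r subr0 !add0r mulr_ge0 ?(ltW sV0)//.
  lra.
have h1 : a * (pi / 2) - s^-1 <= a * atan (a * s ^+ 2).
  have := atan_ge_pihalf (mulr_gt0 a0 s20).
  rewrite -(ler_pM2l a0) mulrBr => /(le_trans _); apply.
  rewrite lerD2l lerN2 invfM mulrA divff ?gt_eqF// mul1r.
  by rewrite lef_pV2 ?posrE// ler_eXnr.
have h2 : ln (1 + a ^+ 2 * (s ^+ 2) ^+ 2) <= 4 * (a + 1) * s.
  have z0 : 0 < (a + 1) * s by rewrite mulr_gt0// addr_gt0.
  have : 1 + a ^+ 2 * (s ^+ 2) ^+ 2 <= (1 + (a + 1) * s) ^+ 4.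
    set z := (a + 1) * s in z0 *.
    have : a ^+ 2 * (s ^+ 2) ^+ 2 <= z ^+ 4.
      have -> : z ^+ 4 = (a + 1) ^+ 4 * (s ^+ 2) ^+ 2 by rewrite /z; ring.
      rewrite ler_pM2r ?exprn_gt0//.
      have -> : (a + 1) ^+ 4 = a ^+ 2 + (a ^+ 4 + 4 * a ^+ 3 + 5 * a ^+ 2 + 4 * a + 1) by ring.
      by rewrite lerDl !addr_ge0 ?mulr_ge0 ?exprn_ge0 ?ltW.
    have -> : (1 + z) ^+ 4 = 1 + z ^+ 4 + (4 * z ^+ 3 + 6 * z ^+ 2 + 4 * z) by ring.
    have := exprn_ge0 2 (ltW z0); have := exprn_ge0 3 (ltW z0); lra.
  have z1 : 0 < 1 + (a + 1) * s by rewrite addr_gt0.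
  move=> hle; have hln : ln (1 + a ^+ 2 * (s ^+ 2) ^+ 2) <= ln ((1 + (a + 1) * s) ^+ 4).
    by rewrite ler_ln ?posrE ?[0 < _ ^+ 4]exprn_gt0 ?sqterm_gt0 ?sqr_ge0.
  apply: le_trans hln _; rewrite lnXn// -(mulr_natl (ln _)) -(mulrA 4).
  by rewrite ler_pM2l// le_ln1Dx// (lt_trans (ltrN10 _)).
have h3 : ln (1 + a ^+ 2 * (s ^+ 2) ^+ 2) / s ^+ 2 <= 4 * (a + 1) / s.
  rewrite ler_pdivrMr// (le_trans h2)// expr2 mulrA -(mulrA _ s^-1) mulVf ?mulr1//.
  by rewrite gt_eqF.
nra.
Qed.

End Coulson.

(** * Sums of lists compared through their products *)

Section Compare.
Variable R : realType.
Implicit Types (c x y K : R) (a b l : seq R).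

Lemma is_derive_exprn n x : is_derive x 1 (fun z : R => z ^+ n.+1) (n.+1%:R * x ^+ n).
Proof.
elim: n => [|n IH].
  by rewrite expr0 mulr1 (_ : (fun z => _) = id)//; exact: is_derive_id.
have -> : (fun z : R => z ^+ n.+2) = id * (fun z => z ^+ n.+1) :> (R -> R).
  by apply/funext => z; rewrite exprS.
have /is_derive_eq := is_deriveM (is_derive_id x (1 : R)) IH.
by apply; rewrite /GRing.scale /= (mulrS 1 n.+1) exprS; ring.
Qed.

(** Because ln (1 + u) <= u, the integrand for [b] exceeds the one for [a] by at most K x^(2k), and
    the bound is the integral of this over [0, c]. *)
Lemma coulson_sub_lower a b K k c : all (Num.le 0) a -> all (Num.le 0) b ->
  0 < c -> 0 <= K ->
  (forall y, 0 < y < c ^+ 2 -> sqprod b y <= sqprod a y * (1 + K * y ^+ k.+1)) ->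
  - (K * c ^+ (2 * k).+1 / (2 * k).+1%:R) <= coulson a c - coulson b c.
Proof.
move=> a0 b0 c0 K0 H.
set C := (\sum_(z <- a) 2 * z ^+ 2) + \sum_(z <- b) 2 * z ^+ 2.
have C0 : 0 <= C by rewrite addr_ge0// sumr_ge0// => z _; rewrite mulr_ge0 ?sqr_ge0.
pose g x := K * x ^+ (2 * k).+1 / (2 * k).+1%:R.
have g0 x : 0 <= x -> 0 <= g x by move=> x0; rewrite /g !mulr_ge0 ?exprn_ge0// invr_ge0.
have key d : 0 < d < c -> - (C * d) <= coulson a c - coulson b c + g c.
  move=> /andP[d0 dc].
  pose f := (coulson a - coulson b) + g.
  have df x : d <= x <= c -> is_derive x 1 f
      (ln (sqprod a (x ^+ 2)) / x ^+ 2 - ln (sqprod b (x ^+ 2)) / x ^+ 2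
      + K * x ^+ (2 * k)).
    move=> /andP[dx _]; have x0 : 0 < x by exact: lt_le_trans dx.
    apply: is_deriveD.
      by apply: is_deriveB; exact: is_derive_coulson.
    have -> : g = (K / (2 * k).+1%:R) \*: (fun z : R => z ^+ (2 * k).+1).
      by apply/funext => z; rewrite /g /GRing.scale/= mulrAC.
    have /is_derive_eq := is_deriveZ (K / (2 * k).+1%:R) (is_derive_exprn (2 * k) x).
    by apply; rewrite /GRing.scale /= mulrA divfK ?pnatr_eq0.
  have df0 x : d < x < c -> 0 <= ln (sqprod a (x ^+ 2)) / x ^+ 2
      - ln (sqprod b (x ^+ 2)) / x ^+ 2 + K * x ^+ (2 * k).
    move=> /andP[dx xc]; have x0 : 0 < x by exact: lt_trans dx.
    have x20 : 0 < x ^+ 2 by rewrite exprn_gt0.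
    have Kx0 : 0 <= K * (x ^+ 2) ^+ k.+1.
      by apply: mulr_ge0 => //; apply: exprn_ge0; exact: ltW.
    have h1 : 0 < 1 + K * (x ^+ 2) ^+ k.+1 by rewrite ltr_pwDl.
    have : ln (sqprod b (x ^+ 2)) <= ln (sqprod a (x ^+ 2)) + K * (x ^+ 2) ^+ k.+1.
      apply: (@le_trans _ _ (ln (sqprod a (x ^+ 2) * (1 + K * (x ^+ 2) ^+ k.+1)))).
        rewrite ler_ln ?posrE ?mulr_gt0 ?sqprod_gt0 ?(ltW x20)//.
        by rewrite H// x20 ltr_pXn2r// nnegrE ltW.
      rewrite lnM ?posrE ?sqprod_gt0 ?(ltW x20)// lerD2l le_ln1Dx//.
      exact: lt_le_trans (ltrN10 _) Kx0.
    have -> : K * (x ^+ 2) ^+ k.+1 = K * x ^+ (2 * k) * x ^+ 2.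
      by rewrite -exprM -mulrA -exprD mulnS addnC.
    move=> h; set v := ln _ in h *; set u := ln _ in h *.
    have -> : u / x ^+ 2 - v / x ^+ 2 + K * x ^+ (2 * k)
        = (u + K * x ^+ (2 * k) * x ^+ 2 - v) / x ^+ 2.
      by rewrite mulrBl mulrDl mulfK ?gt_eqF// addrAC.
    by rewrite divr_ge0 ?(ltW x20)// subr_ge0.
  have := derive_nondecr (ltW dc) df df0.
  rewrite -[X in X <= _]/(coulson a d - coulson b d + g d).
  rewrite -[X in _ <= X]/(coulson a c - coulson b c + g c).
  apply: le_trans.
  have := coulson_small a0 d0; have := coulson_small b0 d0.
  rewrite !ler_norml /C mulrDl => /andP[h1 h2] /andP[h3 h4].
  have := g0 d (ltW d0); lra.
(* A violation would be a fixed positive gap, whereas the lower endpoint d can be taken so small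
   that C d stays below it. *)
rewrite lerNl -subr_le0; rewrite -/(g c) leNgt; apply/negP.
set D := _ - _ => D0.
have {}D0 : 0 < - (coulson a c - coulson b c + g c) by move: D0; rewrite /D; lra.
set D' := - _ in D0.
have := key (Num.min (c / 2) (D' / (2 * (C + 1)))).
have C1 : 0 < 2 * (C + 1) by lra.
rewrite lt_min gt_min !divr_gt0//= ltr_pdivrMr// ltr_pMr// ltr1n/=.
move=> /(_ isT); rewrite leNgt => /negP; apply.
rewrite ltrNr; apply: (@le_lt_trans _ _ (C * (D' / (2 * (C + 1))))).
  by rewrite ler_wpM2l// ge_min lexx orbT.
rewrite mulrCA gtr_pMr// ltr_pdivrMr// mul1r; lra.
Qed.

Lemma coulson_sub_nondecr a b p q : 0 < p -> p <= q ->
  (forall y, p ^+ 2 < y -> sqprod b y <= sqprod a y) ->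
  coulson a p - coulson b p <= coulson a q - coulson b q.
Proof.
move=> p0 pq H.
have := @derive_nondecr R (coulson a - coulson b) (fun x =>
  ln (sqprod a (x ^+ 2)) / x ^+ 2 - ln (sqprod b (x ^+ 2)) / x ^+ 2) p q pq.
apply=> x /andP[px _].
  have x0 := lt_le_trans p0 px.
  by apply: is_deriveB; exact: is_derive_coulson.
have x0 := lt_trans p0 px; have x20 : 0 < x ^+ 2 by rewrite exprn_gt0.
rewrite subr_ge0 ler_pM2r ?invr_gt0// ler_ln ?posrE ?sqprod_gt0 ?(ltW x20)//.
by rewrite H// ltr_pXn2r// nnegrE ltW.
Qed.

Lemma coulson_sub_incr a b p q : 0 < p -> p < q ->
  (forall y, p ^+ 2 < y -> sqprod b y < sqprod a y) ->
  coulson a p - coulson b p < coulson a q - coulson b q.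
Proof.
move=> p0 pq H.
have := @derive_incr R (coulson a - coulson b) (fun x =>
  ln (sqprod a (x ^+ 2)) / x ^+ 2 - ln (sqprod b (x ^+ 2)) / x ^+ 2) p q pq.
apply=> x /andP[px _].
  have x0 := lt_le_trans p0 px.
  by apply: is_deriveB; exact: is_derive_coulson.
have x0 := lt_trans p0 px; have x20 : 0 < x ^+ 2 by rewrite exprn_gt0.
rewrite subr_gt0 ltr_pM2r ?invr_gt0// ltr_ln ?posrE ?sqprod_gt0 ?(ltW x20)//.
by rewrite H// ltr_pXn2r// nnegrE ltW.
Qed.

Lemma coulson_sub_pi a b K c : all (Num.le 0) a -> all (Num.le 0) b -> 0 < c ->
  (forall x, c <= x -> K <= coulson a x - coulson b x) ->
  K <= pi * (\sum_(z <- a) z - \sum_(z <- b) z).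
Proof.
move=> a0 b0 c0 H; rewrite leNgt; apply/negP; rewrite -subr_gt0.
set e := _ - _ => e0.
set C := \sum_(z <- b) (2 + 4 * (z + 1)).
have C0 : 0 <= C.
  rewrite /C big_seq sumr_ge0// => z /(allP b0) z0.
  by rewrite !addr_ge0 ?mulr_ge0 ?addr_ge0.
(* Large enough for c <= s^2 and for the tail C / s to be less than the supposed deficit e. *)
pose s := 1 + c + C / e.
have Ce : 0 <= C / e by rewrite divr_ge0// ltW.
have s1 : 1 <= s by rewrite /s; lra.
have s0 := lt_le_trans ltr01 s1.
have cs : c <= s ^+ 2.
  by apply: (@le_trans _ _ s); [rewrite /s; lra|rewrite ler_eXnr].
have h1 := H _ cs.
have h2 := coulson_le_pi a0 (lt_le_trans c0 cs).
have h3 := pi_le_coulson b0 s1.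
have : C / s < e.
  rewrite ltr_pdivrMr// /s mulrDr mulrCA divff ?gt_eqF// mulr1 ltrDr.
  by rewrite mulr_gt0// ltr_wpDr// ltW.
rewrite -/C in h3; move: h1 h2 h3; rewrite /e mulrBr; lra.
Qed.

(* The error term integrates to [K c^(2k+1) / (2k+1)] over [0, c]. *)
Lemma sqprod_sum_err a b K k c : all (Num.le 0) a -> all (Num.le 0) b ->
  0 < c -> 0 <= K ->
  (forall y, 0 < y < c ^+ 2 -> sqprod b y <= sqprod a y * (1 + K * y ^+ k.+1)) ->
  (forall y, c ^+ 2 < y -> sqprod b y <= sqprod a y) ->
  - (K * c ^+ (2 * k).+1 / (2 * k).+1%:R)
    <= pi * (\sum_(z <- a) z - \sum_(z <- b) z).
Proof.
move=> a0 b0 c0 K0 H1 H2; apply: (@coulson_sub_pi _ _ _ c) => // x cx.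
exact: le_trans (coulson_sub_lower a0 b0 c0 K0 H1) (coulson_sub_nondecr c0 cx H2).
Qed.

Lemma sqprod_sum_le a b : all (Num.le 0) a -> all (Num.le 0) b ->
  (forall y, 0 < y -> sqprod b y <= sqprod a y) ->
  \sum_(z <- b) z <= \sum_(z <- a) z.
Proof.
move=> a0 b0 H; have := @sqprod_sum_err a b 0 0 1 a0 b0 ltr01 (lexx _).
rewrite !mul0r oppr0 pmulr_rge0 ?pi_gt0// subr_ge0; apply => y.
  by move=> /andP[y0 _]; rewrite mul0r addr0 mulr1 H.
by move=> y1; rewrite H// (lt_trans _ y1)// expr1n.
Qed.

(** The strict gain is collected on [1, 2]; outside this interval monotonicity suffices. *)
Lemma sqprod_sum_lt a b : all (Num.le 0) a -> all (Num.le 0) b ->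
  (forall y, 0 < y -> sqprod b y < sqprod a y) ->
  \sum_(z <- b) z < \sum_(z <- a) z.
Proof.
move=> a0 b0 H; rewrite -subr_gt0 -(pmulr_rgt0 _ (pi_gt0 R)).
have h1 : 0 <= coulson a 1 - coulson b 1.
  have := @coulson_sub_lower a b 0 0 1 a0 b0 ltr01 (lexx _).
  rewrite !mul0r oppr0; apply => y /andP[y0 _].
  by rewrite mul0r addr0 mulr1 ltW// H.
have h2 : coulson a 1 - coulson b 1 < coulson a 2 - coulson b 2.
  apply: coulson_sub_incr; rewrite ?ltr1n// => y y1; apply: H.
  by rewrite (lt_trans _ y1)// expr1n.
apply: lt_le_trans (le_lt_trans h1 h2) _.
apply: (@coulson_sub_pi _ _ _ 2) => // x x2.
apply: coulson_sub_nondecr => // y y2; apply/ltW/H.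
by rewrite (lt_trans _ y2)// exprn_gt0.
Qed.

End Compare.

End CoulsonIntegral.

Import CoulsonIntegral.

(** * Trees built by joining roots *)

(* [Graft t s] joins the roots of [t] and [s] by an edge and keeps the root of
   [t]. Every rooted tree arises in this way, usually in several ways. *)
Inductive rtree := Root | Graft of rtree & rtree.

(* The subgraph induced on [S] is the tree [t] with root [r]. *)
Fixpoint realizes (V : finType) (e : rel V) (t : rtree) (S : {set V}) (r : V) : Prop :=
  match t with
  | Root => S = [set r]
  | Graft t s => exists S1 S2 c,
     [/\ S = S1 :|: S2, [disjoint S1 & S2], realizes e t S1 r, realizes e s S2 c &
         forall x y, x \in S1 -> y \in S2 -> e x y = (x == r) && (y == c)]
  end.

Fixpoint nchild (t : rtree) : nat := if t is Graft t _ then (nchild t).+1 else 0.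

(** The degree of a vertex other than the root is its number of children plus one, for its parent.
    With an indicator for [F] the sum counts vertices of prescribed degree. *)
Fixpoint sum_nonroot (F : nat -> nat) (t : rtree) : nat :=
  if t is Graft t s then sum_nonroot F t + sum_nonroot F s + F (nchild s).+1 else 0.

Definition sum_degree (F : nat -> nat) (t : rtree) : nat := F (nchild t) + sum_nonroot F t.

Definition order (t : rtree) : nat := (sum_nonroot (fun=> 1) t).+1.

Lemma order_graft t s : order (Graft t s) = order t + order s.
Proof. by rewrite /order /=; lia. Qed.

Section Realizes.
Variables (V : finType) (e : rel V).
Hypotheses (symE : symmetric e) (irrE : irreflexive e).
Implicit Types (t s : rtree) (S : {set V}) (r x y : V).

Lemma realizes_root t S r : realizes e t S r -> r \in S.
Proof.
elim: t S r => [|t IH s _] S r /=; first by move->; rewrite inE.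
by move=> [S1 [S2 [c [-> _ /IH h _ _]]]]; rewrite inE h.
Qed.

Definition degree_in S x := #|[set y in S | e x y]|.

Lemma degree_in_graft (S1 S2 : {set V}) r c x : [disjoint S1 & S2] ->
  (forall x y, x \in S1 -> y \in S2 -> e x y = (x == r) && (y == c)) -> c \in S2 ->
  x \in S1 -> degree_in (S1 :|: S2) x = degree_in S1 x + (x == r).
Proof.
move=> dis H cS2 xS1; rewrite /degree_in.
have -> : [set y in S1 :|: S2 | e x y] = [set y in S1 | e x y] :|: [set y in S2 | e x y].
  by apply/setP => y; rewrite !inE andb_orl.
rewrite cardsU (_ : _ :&: _ = set0) ?cards0 ?subn0; last first.
  apply/setP => y; rewrite !inE; have [yS1|//] := boolP (y \in S1).
  by rewrite (disjointFr dis yS1)/= !andbF.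
congr addn; have [xr|xr] := eqVneq x r.
  rewrite (_ : [set _ in _ | _] = [set c]) ?cards1//; apply/setP => y; rewrite !inE.
  have [yS2|yS2] /= := boolP (y \in S2); first by rewrite H// xr eqxx.
  by case: eqP yS2 => // ->; rewrite cS2.
rewrite (_ : [set _ in _ | _] = set0) ?cards0//; apply/setP => y; rewrite !inE.
by have [yS2|//] := boolP (y \in S2); rewrite H// (negPf xr).
Qed.

Lemma sum_degree_in F t S r : realizes e t S r ->
  degree_in S r = nchild t /\
  \sum_(x in S | x != r) F (degree_in S x) = sum_nonroot F t.
Proof.
elim: t S r => [|t IHt s IHs] S r /=.
  move=> ->; split.
    rewrite /degree_in (_ : [set _ in _ | _] = set0) ?cards0//; apply/setP => y.
    by rewrite !inE; have [->|//] := eqVneq y r; rewrite irrE.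
  by rewrite big1// => x; rewrite inE; case: eqP.
move=> [S1 [S2 [c [-> dis H1 H2 H]]]].
have rS1 := realizes_root H1; have cS2 := realizes_root H2.
have [d1 s1] := IHt _ _ H1; have [d2 s2] := IHs _ _ H2.
have H' x y : x \in S2 -> y \in S1 -> e x y = (x == c) && (y == r).
  by move=> xS yS; rewrite symE H// andbC.
have dis' : [disjoint S2 & S1] by rewrite disjoint_sym.
have D2 x : x \in S2 -> degree_in (S1 :|: S2) x = degree_in S2 x + (x == c).
  by move=> xS; rewrite setUC (degree_in_graft dis' H').
split; first by rewrite (degree_in_graft dis H)// d1 eqxx addn1.
rewrite (eq_bigl (fun x => (x \in S1) && (x != r) || (x \in S2))); last first.
  move=> x; rewrite !inE; have [xS2|_] := boolP (x \in S2); last by rewrite !orbF.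
  by rewrite !orbT/=; apply: contraTneq xS2 => ->; rewrite (disjointFr dis).
rewrite (eq_bigl [predU [pred x | (x \in S1) && (x != r)] & S2])//.
rewrite bigU/=; last first.
  by apply: disjointWl dis; apply/subsetP => x; rewrite !inE => /andP[].
rewrite -addnA; congr addn.
  rewrite -s1; apply: eq_bigr => x /andP[xS1 xr].
  by rewrite (degree_in_graft dis H)// (negPf xr) addn0.
rewrite (bigD1 c)//= addnC -s2 D2// d2 eqxx addn1; congr addn.
by apply: eq_bigr => x /andP[xS2 xc]; rewrite D2// (negPf xc) addn0.
Qed.

Lemma degree_in_setT x : degree_in setT x = degree e x.
Proof.
by rewrite /degree_in /degree; congr #|pred_of_set _|; apply/setP => y; rewrite !inE.
Qed.

Lemma sum_degreeP F t r : realizes e t setT r ->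
  \sum_x F (degree e x) = sum_degree F t.
Proof.
move=> H; have [d s] := sum_degree_in F H.
rewrite (bigD1 r)//= -degree_in_setT d /sum_degree -s; congr addn.
by apply: eq_big => [x|x _]; rewrite ?inE ?degree_in_setT.
Qed.

Lemma degree_root t r : realizes e t setT r -> degree e r = nchild t.
Proof. by move=> H; rewrite -degree_in_setT (sum_degree_in id H).1. Qed.

Lemma realizes_card t r : realizes e t setT r -> #|V| = order t.
Proof.
by move=> H; have := sum_degreeP (fun=> 1) H; rewrite sum1_card => ->.
Qed.

Lemma realizes_graft_sub (t t' s s' : rtree) S r :
  (forall S r, realizes e t S r -> realizes e t' S r) ->
  (forall S r, realizes e s S r -> realizes e s' S r) ->
  realizes e (Graft t s) S r -> realizes e (Graft t' s') S r.
Proof.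
move=> ht hs /= [S1 [S2 [c [eS dis H1 H2 H]]]].
by exists S1, S2, c; split => //; [exact: ht|exact: hs].
Qed.

(** This and [realizes_reroot] account for the different encodings of one tree: the order of
    grafting is immaterial, and the root may move along an edge. *)
Lemma realizes_swap t a b S r :
  realizes e (Graft (Graft t a) b) S r -> realizes e (Graft (Graft t b) a) S r.
Proof.
move=> /= [S1 [B [cb [-> disB [T [A [ca [eS1 disA HT HA eTA]]]] HB eTAB]]]]; subst S1.
have [dTB dAB] : [disjoint T & B] /\ [disjoint A & B].
  by split; apply: disjointWl disB; apply/subsetP => x; rewrite inE => ->; rewrite ?orbT.
have rT := realizes_root HT; have rA : r \in A = false by rewrite (disjointFr disA).
exists (T :|: B), A, ca; split => //.
- by rewrite -!setUA (setUC A).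
- by rewrite -setI_eq0 setIUl setU_eq0 !setI_eq0 disA disjoint_sym dAB.
- by exists T, B, cb; split => // x y xT yB; rewrite eTAB// inE xT.
move=> x y; rewrite inE => /orP[xT yA|xB yA]; first exact: eTA.
rewrite symE eTAB ?inE ?yA ?orbT//.
have -> : (y == r) = false by apply: contraTF yA => /eqP ->; rewrite rA.
have -> // : (x == r) = false.
by apply: contraTF xB => /eqP ->; rewrite (disjointFr dTB).
Qed.

Lemma realizes_reroot t s r : realizes e (Graft t s) setT r ->
  exists r', realizes e (Graft s t) setT r'.
Proof.
move=> /= [S1 [S2 [c [-> dis H1 H2 H]]]]; exists c, S2, S1, r; split => //.
- by rewrite setUC.
- by rewrite disjoint_sym.
by move=> x y xS yS; rewrite symE H// andbC.
Qed.

End Realizes.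

Section Iso.
Variables (V W : finType) (e : rel V) (f : rel W).
Hypotheses (symE : symmetric e) (irrE : irreflexive e).
Hypotheses (fsym : symmetric f) (firr : irreflexive f).

(** The bijections of the two halves glue, since [realizes] prescribes every edge between them. *)
Lemma realizes_iso_in t S r S' r' : realizes e t S r -> realizes f t S' r' ->
  exists h : V -> W, [/\ h r = r', {in S &, injective h}, h @: S = S' &
    {in S &, forall x y, f (h x) (h y) = e x y}].
Proof.
elim: t S r S' r' => [|t IHt s IHs] S r S' r' /=.
  move=> -> ->; exists (fun=> r'); split => //.
  - by move=> x y; rewrite !inE => /eqP -> /eqP ->.
  - by rewrite imset_set1.
  - by move=> x y; rewrite !inE => /eqP -> /eqP ->; rewrite irrE firr.
move=> [S1 [S2 [c [-> dis H1 H2 H]]]] [S1' [S2' [c' [-> dis' H1' H2' H']]]].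
have [h1 [h1r i1 m1 e1]] := IHt _ _ _ _ H1 H1'.
have [h2 [h2r i2 m2 e2]] := IHs _ _ _ _ H2 H2'.
have rS1 := realizes_root H1; have cS2 := realizes_root H2.
pose h x := if x \in S1 then h1 x else h2 x.
have hS1 x : x \in S1 -> h x = h1 x by rewrite /h => ->.
have hS2 x : x \in S2 -> h x = h2 x by rewrite /h => xS2; rewrite (disjointFl dis).
have m1x x : x \in S1 -> h1 x \in S1' by move=> xS; rewrite -m1 imset_f.
have m2x x : x \in S2 -> h2 x \in S2' by move=> xS; rewrite -m2 imset_f.
have cross x y : x \in S1 -> y \in S2 -> f (h1 x) (h2 y) = e x y.
  move=> xS yS; rewrite H'; [|exact: m1x|exact: m2x].
  by rewrite H// -h1r -h2r (inj_in_eq i1)// (inj_in_eq i2).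
exists h; split.
- by rewrite hS1.
- move=> x y; rewrite !inE => /orP[] xS /orP[] yS;
    rewrite ?(hS1 _ xS) ?(hS2 _ xS) ?(hS1 _ yS) ?(hS2 _ yS).
  + exact: i1.
  + by move=> E; have := m1x _ xS; rewrite E (disjointFl dis') ?m2x.
  + by move=> E; have := m1x _ yS; rewrite -E (disjointFl dis') ?m2x.
  + exact: i2.
- rewrite imsetU -m1 -m2; congr setU; apply: eq_in_imset => x xS; [exact: hS1|exact: hS2].
move=> x y; rewrite !inE => /orP[] xS /orP[] yS;
  rewrite ?(hS1 _ xS) ?(hS2 _ xS) ?(hS1 _ yS) ?(hS2 _ yS).
- exact: e1.
- exact: cross.
- by rewrite fsym cross// symE.
- exact: e2.
Qed.

Lemma realizes_iso t r r' : realizes e t setT r -> realizes f t setT r' ->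
  graph_iso e f.
Proof.
move=> H H'; have [h [_ hi hm he]] := realizes_iso_in H H'.
exists h; last by move=> x y; apply: he; rewrite inE.
apply: inj_card_bij => [x y|]; first by apply: hi; rewrite inE.
by rewrite -!cardsT -hm leq_imset_card.
Qed.

End Iso.

Lemma realizes_pull (V W : finType) (e : rel V) (f : rel W) (h : V -> W) t S r :
  bijective h -> (forall x y, f (h x) (h y) = e x y) ->
  realizes f t S (h r) -> realizes e t (h @^-1: S) r.
Proof.
move=> hb he; have hi := bij_inj hb.
elim: t S r => [|t IHt s IHs] S r /=.
  by move=> ->; apply/setP => x; rewrite !inE inj_eq.
move=> [S1 [S2 [c' [-> dis H1 H2 H]]]]; have [g hg gh] := hb.
have ec : h (g c') = c' by [].
exists (h @^-1: S1), (h @^-1: S2), (g c'); split.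
- by rewrite preimsetU.
- rewrite -setI_eq0 -preimsetI; move: dis; rewrite -setI_eq0 => /eqP ->.
  by rewrite preimset0.
- exact: IHt.
- by apply: IHs; rewrite ec.
- move=> x y; rewrite !inE => xS yS.
  by rewrite -he H// -[in RHS](inj_eq hi) -[y == _](inj_eq hi) ec.
Qed.

(** * Every tree has an encoding *)

Section Existence.
Variables (V : finType) (e : rel V).
Hypotheses (symE : symmetric e) (irrE : irreflexive e) (eacy : acyclic e).
Implicit Types (S : {set V}) (r c x y : V).

Definition restrict S : rel V := [rel x y | [&& e x y, x \in S & y \in S]].

Lemma restrict_path_mem S x p : path (restrict S) x p -> {subset p <= S}.
Proof.
elim: p x => [|y p IH] x //= /andP[/and3P[_ _ yS] /IH sub] z.
by rewrite inE => /predU1P[->|/sub].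
Qed.

Lemma restrict_path_sub (S S' : {set V}) x p : path (restrict S) x p ->
  x \in S' -> {subset p <= S'} -> path (restrict S') x p.
Proof.
elim: p x => [|y p IH] x //= /andP[/and3P[xy _ _] hp] xS' sub.
have yS' : y \in S' by apply: sub; rewrite mem_head.
apply/andP; split; first exact/and3P.
apply: IH => // z zp; apply: sub.
by rewrite inE zp orbT.
Qed.

Lemma restrict_path x p S : path (restrict S) x p -> path e x p.
Proof. by apply: sub_path => ? ? /and3P[]. Qed.

(** Split off a neighbour c of r together with its component in the graph without r; acyclicity
    leaves r c as the only edge between the two sides. *)
Lemma connected_realizes n S r : #|S| <= n -> r \in S ->
  (forall x, x \in S -> connect (restrict S) r x) -> exists t, realizes e t S r.
Proof.
elim: n S r => [|n IH] S r.
  by rewrite leqn0 cards_eq0 => /eqP ->; rewrite inE.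
move=> Sn rS conn; have [S1|/eqP Sr] := eqVneq S [set r]; first by exists Root.
have [c /and3P[rc _ cS]] : exists c, restrict S r c.
  have [x xS xr] : exists2 x, x \in S & x != r.
    apply/exists_inP; apply: contra_notT Sr; rewrite negb_exists_in => /forall_inP h.
    apply/setP => x; rewrite inE; apply/idP/eqP => [/h|->//].
    by rewrite negbK => /eqP.
  have /connectP[[|c p] /= hp hx] := conn x xS; first by rewrite hx eqxx in xr.
  by exists c; case/andP: hp.
have cr : c != r by apply: contraTneq rc => ->; rewrite irrE.
set S2 := [set x | connect (restrict (S :\ r)) c x].
have S2S : S2 \subset S :\ r.
  apply/subsetP => x; rewrite inE => /connectP[p hp ->].
  case/lastP: p hp => [|p z] hp /=; first by rewrite !inE cr.
  by rewrite last_rcons (restrict_path_mem hp)// mem_rcons mem_head.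
have cS2 : c \in S2 by rewrite inE connect0.
set S1 := S :\: S2.
have rS1 : r \in S1.
  by rewrite inE rS andbT; apply/negP => /(subsetP S2S); rewrite !inE eqxx.
have S2close x y : x \in S2 -> y \in S -> y != r -> e x y -> y \in S2.
  move=> xS2 yS yr xy; have := subsetP S2S _ xS2; rewrite inE => xS.
  move: (xS2); rewrite !inE => /connect_trans; apply; apply: connect1.
  by apply/and3P; split=> //; rewrite !inE ?yS ?yr //; move: xS; rewrite !inE.
have card : #|S1| + #|S2| = #|S|.
  rewrite -(cardsID S2 S) addnC -/S1; congr (_ + _); congr #|pred_of_set _|.
  by apply/esym/setIidPr; apply: subset_trans S2S (subsetDl _ _).
have [||t Ht] := IH S1 r _ rS1.
- have : 0 < #|S2| by apply/card_gt0P; exists c.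
  by lia.
- move=> x xS1; have xS : x \in S by move: xS1; rewrite inE => /andP[].
  have /connectP[p0 hp0 ex] := conn x xS.
  move: xS1; rewrite ex; case/shortenP: hp0 => p hp up _ xS1 {ex p0}.
  apply/connectP; exists p => //.
  apply: (restrict_path_sub hp rS1) => z zp; rewrite inE (restrict_path_mem hp zp) andbT.
  (* A path that has entered [S2] can leave it only through r, and a path without repetition that
     starts at r does not meet r again. *)
  apply: contraTN xS1 => zS2; case/splitPr: zp hp up => p1 p2.
  rewrite cat_path last_cat /= => /and3P[_ _ hp2] /andP[].
  rewrite mem_cat inE !negb_or => /and3P[_ _ rp2] _; rewrite inE negb_and negbK.
  apply/orP; left.
  elim: p2 z zS2 hp2 rp2 => [|w p2 IHp] z zS2 //= /andP[/and3P[zw _ wS] hp2].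
  rewrite inE negb_or => /andP[rw rp2]; apply: IHp => //.
  by apply: (S2close z) => //; rewrite eq_sym.
have [||s Hs] := IH S2 c _ cS2.
- have : 0 < #|S1| by apply/card_gt0P; exists r.
  by lia.
- move=> x; rewrite inE => /connectP[p hp ->].
  apply/connectP; exists p => //; apply: (restrict_path_sub hp cS2) => z zp.
  case/splitPl: (mem_behead (s := c :: p) zp) hp => p1 p2 <-.
  by rewrite cat_path inE => /andP[hp _]; apply/connectP; exists p1.
exists (Graft t s), S1, S2, c; split => //.
- rewrite -{1}(setID S S2) setUC; congr setU; apply/setIidPr.
  exact: subset_trans S2S (subsetDl _ _).
- rewrite -setI_eq0; apply/eqP/setP => x.
  rewrite [in X in _ = X]inE in_setI in_setD.
  by case: (x \in S2); rewrite /= ?andbF.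
move=> x y; rewrite inE => /andP[xS2 xS] yS2.
have [xr|xr] := eqVneq x r; last first.
  by apply: contraNF xS2 => xy; apply: (S2close y) => //; rewrite symE.
rewrite xr andTb; apply/idP/eqP => [ry|->//].
(* A second edge, from r to y in [S2], would close a cycle with a path from c to y inside [S2]. *)
apply/eqP; apply/negPn/negP => yc.
move: (yS2); rewrite inE => /connectP[p0 hp0 ey].
move: yc ry; rewrite ey; case/shortenP: hp0 => p hp up _ yc ry {ey p0}.
have pr : r \notin c :: p.
  rewrite inE negb_or eq_sym cr; apply/negP => /(restrict_path_mem hp).
  by rewrite !inE eqxx.
have : ucycle e (r :: c :: p).
  rewrite /ucycle /= rcons_path rc (restrict_path hp) [e _ r]symE ry.
  by move: pr up => /= -> ->.
by move/eacy => /=; case: p yc {hp up ry pr} => //=; rewrite eqxx.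
Qed.

Lemma tree_realizes r : (forall x y, connect e x y) -> exists t, realizes e t setT r.
Proof.
move=> conn; apply: (@connected_realizes #|[set: V]|) => // x _.
have eqe : restrict [set: V] =2 e by move=> a b; rewrite /restrict /= !in_setT !andbT.
by rewrite (eq_connect eqe).
Qed.

End Existence.

(** * Energy and the matching polynomial *)

Local Open Scope ring_scope.

Section MatchingPolynomial.
Variable R : pzRingType.

(* [sum_k m_k y^k], with [m_k] the number of matchings of size [k], for the tree
   and for the tree without its root. *)
Fixpoint match_pair (t : rtree) (y : R) : R * R :=
  if t is Graft t s then
    let: (a, a') := match_pair t y in let: (b, b') := match_pair s y in
    (a * b + y * (a' * b'), a' * b)
  else (1, 1).

Definition mpol t y := (match_pair t y).1.
Definition mdel t y := (match_pair t y).2.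

Lemma mpol_graft t s y :
  mpol (Graft t s) y = mpol t y * mpol s y + y * (mdel t y * mdel s y).
Proof. by rewrite /mpol /mdel /=; case: match_pair => a a'; case: match_pair. Qed.

Lemma mdel_graft t s y : mdel (Graft t s) y = mdel t y * mpol s y.
Proof. by rewrite /mpol /mdel /=; case: match_pair => a a'; case: match_pair. Qed.

End MatchingPolynomial.

Lemma mpol_gt0 (R : numDomainType) t (y : R) : 0 < y -> 0 < mpol t y /\ 0 < mdel t y.
Proof.
move=> y0; elim: t => [|t [a b] s [c d]]; first by split; exact: ltr01.
by rewrite mpol_graft mdel_graft !(addr_gt0, mulr_gt0).
Qed.

Lemma mpol_morph (R S : pzRingType) (f : {rmorphism R -> S}) t y :
  mpol t (f y) = f (mpol t y) /\ mdel t (f y) = f (mdel t y).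
Proof.
elim: t => [|t [a b] s [c d]]; first by rewrite /mpol /mdel /= rmorph1.
by rewrite !mpol_graft !mdel_graft rmorphD !rmorphM a b c d.
Qed.

Section Parent.
Variables (V : finType) (e : rel V).
Hypotheses (symE : symmetric e) (irrE : irreflexive e).
Implicit Types (t s : rtree) (S : {set V}) (r x : V).

Definition child_of (par : V -> V) r : rel V := fun x c => (c != r) && (par c == x).

Variables (F : numFieldType) (y : F).
Hypothesis y0 : 0 < y.

(* [d x] is the quotient of the matching polynomials of the subtree below [x] and
   of that subtree without [x]. *)
Lemma realizes_parent t S r : realizes e t S r ->
  exists (par : V -> V) (dep : V -> nat) (d : V -> F),
  [/\ {in S &, forall x z, e x z = child_of par r x z || child_of par r z x},
      {in S, forall x, x != r -> par x \in S /\ (dep (par x) < dep x)%N},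
      {in S, forall x, 0 < d x /\ d x = 1 + y * \sum_(c in S | child_of par r x c) (d c)^-1},
      \prod_(x in S) d x = mpol t y &
      d r * mdel t y = mpol t y].
Proof.
elim: t S r => [|t IHt s IHs] S r /=.
  move=> ->; exists id, (fun=> 0%N), (fun=> 1); rewrite /child_of; split.
  - by move=> x z; rewrite !inE => /eqP -> /eqP ->; rewrite irrE eqxx.
  - by move=> x; rewrite inE => ->.
  - move=> x; rewrite inE => /eqP ->; split=> //; rewrite big1 ?mulr0 ?addr0// => c.
    by rewrite inE; case: eqP.
  - by rewrite big1.
  - by rewrite mul1r.
move=> [S1 [S2 [c [-> dis H1 H2 H]]]].
have [par1 [dep1 [d1 [e1 p1 q1 m1 n1]]]] := IHt _ _ H1.
have [par2 [dep2 [d2 [e2 p2 q2 m2 n2]]]] := IHs _ _ H2.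
have rS1 := realizes_root H1; have cS2 := realizes_root H2.
have nS2 x : x \in S1 -> x \in S2 = false by move=> xS; rewrite (disjointFr dis).
have nS1 x : x \in S2 -> x \in S1 = false by move=> xS; rewrite (disjointFl dis).
(* Only r gains a child, namely c, so [d] changes at r alone; the depths in [S2] are shifted to lie
   below r. *)
pose par x := if x \in S2 then if x == c then r else par2 x else par1 x.
pose dep x := if x \in S2 then (dep2 x + (dep1 r).+1)%N else dep1 x.
pose d x := if x \in S2 then d2 x else d1 x + (x == r)%:R * (y / d2 c).
have nr x : x \in S2 -> x != r by apply: contraTneq => ->; rewrite nS2.
have nc x : x \in S1 -> x != c by apply: contraTneq => ->; rewrite nS1.
have ch11 x z : x \in S1 -> z \in S1 -> child_of par r x z = child_of par1 r x z.
  by move=> xS zS; rewrite /child_of /par nS2.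
have ch12 x z : x \in S1 -> z \in S2 -> child_of par r x z = (x == r) && (z == c).
  move=> xS zS; rewrite /child_of nr//= /par zS; have [_|zc] := eqVneq z c.
    by rewrite andbT eq_sym.
  rewrite andbF; apply: contraTF (p2 _ zS zc).1 => /eqP ->; exact: negbT (nS2 _ xS).
have ch21 x z : x \in S2 -> z \in S1 -> child_of par r x z = false.
  move=> xS zS; rewrite /child_of /par nS2//; have [//|zr] := eqVneq z r.
  apply: contraTF (p1 _ zS zr).1 => /eqP ->; exact: negbT (nS1 _ xS).
have ch22 x z : x \in S2 -> z \in S2 -> child_of par r x z = child_of par2 c x z.
  move=> xS zS; rewrite /child_of nr//= /par zS; have [_|//] := eqVneq z c.
  by apply: contraTF xS => /eqP <-; rewrite nS2.
have d2c : 0 < d2 c by have [] := q2 _ cS2.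
have dS2 x : x \in S2 -> d x = d2 x by rewrite /d => ->.
have dS1 x : x \in S1 -> x != r -> d x = d1 x.
  by move=> xS xr; rewrite /d nS2// (negPf xr) mul0r addr0.
have dr : d r = d1 r + y / d2 c by rewrite /d nS2// eqxx mul1r.
have splitU (P : pred V) (f : V -> F) : \sum_(z in S1 :|: S2 | P z) f z =
    \sum_(z in S1 | P z) f z + \sum_(z in S2 | P z) f z.
  rewrite (eq_bigl [predU [pred x | (x \in S1) && P x] & [pred x | (x \in S2) && P x]]).
    rewrite bigU//=; apply/pred0P => x /=; rewrite !inE; apply/negP.
    by move=> /andP[/andP[xS _] /andP[]]; rewrite nS2.
  by move=> x; rewrite !inE andb_orl.
exists par, dep, d; split.
- move=> x z; rewrite !inE => /orP[] xS /orP[] zS.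
  + by rewrite !ch11// e1.
  + by rewrite ch12// ch21// H// orbF.
  + by rewrite ch21// ch12// symE H.
  + by rewrite !ch22// e2.
- move=> x; rewrite !inE => /orP[] xS xr.
    have [h1 h2] := p1 _ xS xr; rewrite /par /dep nS2//; split; first by rewrite h1.
    by rewrite (nS2 _ h1).
  rewrite /par xS; have [->|xc] := eqVneq x c.
    by rewrite rS1; split=> //; rewrite /dep nS2// cS2; lia.
  have [h1 h2] := p2 _ xS xc; rewrite h1 orbT; split=> //.
  by rewrite /dep h1 xS ltn_add2r.
- move=> x; rewrite inE => /orP[] xS; rewrite splitU.
    have [a b] := q1 _ xS.
    have -> : \sum_(z in S1 | child_of par r x z) (d z)^-1 =
              \sum_(z in S1 | child_of par1 r x z) (d1 z)^-1.
      apply: eq_big => [z|z /andP[zS]]; first by have [zS|//] := boolP (z \in S1); rewrite ch11.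
      by move=> /andP[zr _]; rewrite dS1.
    have -> : \sum_(z in S2 | child_of par r x z) (d z)^-1 = (x == r)%:R / d2 c.
      rewrite (eq_bigl (fun z => (z == c) && (x == r))); last first.
        move=> z; have [zS|zS] := boolP (z \in S2); first by rewrite andTb ch12// andbC.
        by case: eqP zS => // ->; rewrite cS2.
      have [xr|xr] := eqVneq x r; last by rewrite big_pred0 ?mul0r// => z; rewrite andbF.
      rewrite (eq_bigl (pred1 c)) ?big_pred1_eq ?dS2 ?mul1r// => z.
      by rewrite /= andbT.
    have dx : d x = d1 x + (x == r)%:R * (y / d2 c) by rewrite /d nS2.
    split; first by rewrite dx ltr_wpDr// mulr_ge0 ?ler0n ?divr_ge0 ?(ltW y0) ?(ltW d2c).
    by rewrite dx b; ring.
  have [a b] := q2 _ xS; rewrite dS2//; split=> //.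
  rewrite b [X in _ * (X + _)]big_pred0 ?add0r; last first.
    by move=> z; have [zS|//] := boolP (z \in S1); rewrite ch21.
  congr (1 + y * _); apply: eq_big => [z|z /andP[zS _]]; last by rewrite dS2.
  by have [zS|//] := boolP (z \in S2); rewrite ch22.
- have mt := (mpol_gt0 t y0).2; have ms := (mpol_gt0 s y0).1.
  have e1' : \prod_(x in S1) d x = mpol t y + y / d2 c * mdel t y.
    rewrite (bigD1 r)//= dr (eq_bigr d1); last by move=> x /andP[xS xr]; rewrite dS1.
    move: m1; rewrite (bigD1 r)//= -n1 => m1.
    have -> : \prod_(x in S1 | x != r) d1 x = mdel t y.
      have d1r : d1 r != 0 by rewrite gt_eqF//; have [] := q1 _ rS1.
      exact: (mulfI d1r).
    by rewrite mulrDl.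
  have e2' : \prod_(x in S2) d x = mpol s y.
    by rewrite -m2; apply: eq_bigr => x xS; rewrite dS2.
  rewrite (eq_bigl [predU S1 & S2]); last by move=> x; rewrite !inE.
  rewrite bigU//= e1' e2' mpol_graft mulrDl; congr (_ + _).
  rewrite -n2 -!mulrA; congr (y * _).
  by rewrite [_ * (d2 c * _)]mulrCA mulrA mulVf ?gt_eqF// mul1r.
have mt := (mpol_gt0 t y0).2; have ms := (mpol_gt0 s y0).1.
rewrite dr mdel_graft mpol_graft mulrDl [d1 r * _]mulrA n1; congr (_ + _).
rewrite -n2 -!mulrA; congr (y * _).
by field; rewrite gt_eqF.
Qed.

End Parent.

(** A permutation preserves the sum of the ranks, so unless it is the identity it cannot raise the
    rank at every point that it moves, and its term vanishes. *)
Lemma det_triangular_rank (F : comNzRingType) n (A : 'M[F]_n) (rk : 'I_n -> nat) :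
  (forall i j, i != j -> (rk j <= rk i)%N -> A i j = 0) ->
  \det A = \prod_i A i i.
Proof.
move=> H; rewrite /determinant (bigD1 (1%g : 'S_n))//= odd_perm1 expr0 mul1r.
rewrite [X in _ + X]big1 ?addr0; first by apply: eq_bigr => i _; rewrite perm1.
move=> s s1; suff [i si rsi] : exists2 i, i != s i & (rk (s i) <= rk i)%N.
  by rewrite (bigD1 i)//= H// mul0r mulr0.
apply/exists_inP; apply: contraT; rewrite negb_exists_in => /forall_inP h; exfalso.
have h' i : i != s i -> (rk i < rk (s i))%N by move/h; rewrite -ltnNge.
have [i im] : exists i, i != s i.
  apply/existsP; apply: contraR s1; rewrite negb_exists => /forallP si.
  by apply/eqP/permP => i; rewrite perm1; move: (si i); rewrite negbK => /eqP.
have : (\sum_i rk i = \sum_i rk (s i))%N by rewrite [LHS](reindex_inj (@perm_inj _ s)).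
apply/eqP; rewrite neq_ltn; apply/orP; left.
rewrite (bigD1 i)//= [X in (_ < X)%N](bigD1 i)//= -addSn leq_add ?h'//.
by apply: leq_sum => j _; have [<-//|/h' /ltnW] := eqVneq j (s j).
Qed.

(* Symmetric Gaussian elimination along the tree, from the leaves to the root:
   [1 + w A = L D L^T] with [D] the diagonal matrix of the [d x] above and [L]
   unitriangular. *)
Lemma det_adjacency (V : finType) (e : rel V) (F : numFieldType) t r (w y : F) :
  symmetric e -> irreflexive e -> realizes e t setT r -> 0 < y -> w ^+ 2 = - y ->
  \det (1%:M + w *: adjacency e F) = mpol t y.
Proof.
move=> symE irrE H y0 wy.
have [par [dep [d [He Hp Hd Hm _]]]] := realizes_parent symE irrE y0 H.
have d0 x : 0 < d x by have [] := Hd x (in_setT x).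
pose L := \matrix_(i, j < #|V|) ((i == j)%:R
  + (child_of par r (enum_val i) (enum_val j))%:R * (w / d (enum_val j))) : 'M[F]_#|V|.
pose D := diag_mx (\row_(j < #|V|) d (enum_val j)).
have depP x z : child_of par r x z -> (dep x < dep z)%N.
  by move=> /andP[zr /eqP <-]; have [] := Hp z (in_setT z) zr.
have detL : \det L = 1.
  rewrite (@det_triangular_rank _ _ _ (fun i => dep (enum_val i))).
    rewrite big1// => i _; rewrite mxE eqxx; case: (boolP (child_of _ _ _ _)) => [/depP|_].
      by rewrite ltnn.
    by rewrite mul0r addr0.
  move=> i j ij dji; rewrite mxE (negPf ij) add0r.
  case: (boolP (child_of _ _ _ _)) => [/depP|_]; first by rewrite ltnNge dji.
  by rewrite mul0r.
have -> : 1%:M + w *: adjacency e F = L *m D *m L^T.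
  apply/matrixP => i j; rewrite mul_mx_diag !mxE.
  set u := enum_val i; set v := enum_val j.
  have uv : (i == j) = (u == v) by rewrite (inj_eq enum_val_inj).
  rewrite (eq_bigr (fun k => (fun z => ((u == z)%:R + (child_of par r u z)%:R * (w / d z))
      * d z * ((v == z)%:R + (child_of par r v z)%:R * (w / d z))) (enum_val k))); last first.
    by move=> k _; rewrite !mxE -!(inj_eq enum_val_inj).
  rewrite -(big_enum_val (fun z => ((u == z)%:R + (child_of par r u z)%:R * (w / d z))
      * d z * ((v == z)%:R + (child_of par r v z)%:R * (w / d z))))/=.
  have [_ du] := Hd u (in_setT u).
  have -> : \sum_(z in V) ((u == z)%:R + (child_of par r u z)%:R * (w / d z)) * d z *
      ((v == z)%:R + (child_of par r v z)%:R * (w / d z)) =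
      \sum_z (u == z)%:R * ((v == z)%:R * d z) +
      \sum_z (u == z)%:R * ((child_of par r v z)%:R * w) +
      \sum_z (v == z)%:R * ((child_of par r u z)%:R * w) +
      (u == v)%:R * (w ^+ 2 * \sum_z (child_of par r u z)%:R * (d z)^-1).
    rewrite !mulr_sumr -!big_split/=; apply: eq_bigr => z _.
    have dz : d z != 0 by rewrite gt_eqF.
    (* The parent is unique, so a common child of u and v forces u = v. *)
    have -> : (u == v)%:R * (w ^+ 2 * ((child_of par r u z)%:R * (d z)^-1)) =
       (child_of par r u z)%:R * (child_of par r v z)%:R * (w ^+ 2 / d z).
      rewrite /child_of; case: (z != r) => /=; rewrite ?(mul0r, mulr0)//.
      have [->|pu] := eqVneq (par z) u; last by rewrite !(mul0r, mulr0).
      by rewrite !mul1r.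
    by field.
  have pick (x : V) (f : V -> F) : \sum_z (x == z)%:R * f z = f x.
    rewrite (bigD1 x)//= eqxx mul1r big1 ?addr0// => z zx.
    by rewrite eq_sym (negPf zx) mul0r.
  have -> : \sum_z (child_of par r u z)%:R * (d z)^-1 =
      \sum_(z in [set: V] | child_of par r u z) (d z)^-1.
    rewrite [RHS]big_mkcond; apply: eq_bigr => z _; rewrite inE /=.
    by case: (child_of par r u z); rewrite ?mul1r ?mul0r.
  rewrite !pick wy uv.
  have [<-|nuv] := eqVneq u v.
    rewrite irrE mulr0 addr0 mul1r.
    have -> : child_of par r u u = false by apply/negP => /depP; rewrite ltnn.
    (* On the diagonal, w^2 = - y cancels the sum over the children in the recursion for [d u], and
       1 remains. *)
    by rewrite !mul0r !addr0 !mul1r {1}du mulNr addrK.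
  rewrite !mul0r add0r add0r addr0 He ?inE// [RHS]addrC -mulrDl mulrC; congr (_ * _).
  have [h1|_] := boolP (child_of par r u v); last by rewrite orFb add0r.
  have -> : child_of par r v u = false.
    by apply/negP => h2; have := ltn_trans (depP _ _ h1) (depP _ _ h2); rewrite ltnn.
  by rewrite addr0.
rewrite !det_mulmx det_tr detL mul1r mulr1 det_diag -Hm.
rewrite (eq_bigr (fun k => d (enum_val k))); last by move=> k _; rewrite mxE.
rewrite -(big_enum_val d)/=; apply: eq_bigl => x; by rewrite !inE.
Qed.

Lemma det_conj (F : comUnitRingType) n (P M : 'M[F]_n) : P \in unitmx ->
  \det (invmx P *m M *m P) = \det M.
Proof.
move=> Pu; rewrite !det_mulmx mulrC mulrA -det_mulmx mulmxV// det1 mul1r.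
by [].
Qed.

(** The diagonalization takes place over the complex numbers, to which w belongs; the eigenvalues of
    a hermitian matrix being real, the list itself lies in [R]. *)
Lemma symmetric_spectrum (R : rcfType) n (A : 'M[R]_n) : A^T = A ->
  exists s : seq R, char_poly A = \prod_(a <- s) ('X - a%:P) /\
    forall w : R[i], \det (1%:M + w *: map_mx (real_complex R) A) =
       \prod_(a <- s) (1 + w * (real_complex R a)).
Proof.
move=> Asym; pose B := map_mx (real_complex R) A.
have Bh : B \is hermsymmx.
  apply: realsym_hermsym.
    by apply/is_hermitianmxP; rewrite expr0 scale1r map_mx_id// map_trmx Asym.
  by apply/mxOverP => i j; rewrite mxE complex_real.
have Breal := hermitian_spectral_diag_real Bh.
have /orthomx_spectralP BE := hermitian_normalmx Bh.
have Pu := spectral_unit B.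
set P := spectralmx B in BE Pu; set d := spectral_diag B in BE Breal.
pose s := [seq complex.Re (d 0 i) | i : 'I_n].
have dE i : d 0 i = real_complex R (complex.Re (d 0 i)).
  by have /mxOverP/(_ 0 i)/complex_realP[x ->] := Breal.
exists s; split.
  apply: (map_inj_poly (@complexI R) (rmorph0 _)).
  rewrite map_char_poly -/B rmorph_prod/= /s big_image/=.
  have PP : map_mx polyC (invmx P) *m map_mx polyC P = 1%:M.
    by rewrite -map_mxM mulVmx// map_mx1.
  rewrite /char_poly /char_poly_mx {1}BE !map_mxM/=.
  have -> : 'X%:M - map_mx polyC (invmx P) *m map_mx polyC (diag_mx d) *m map_mx polyC P
      = map_mx polyC (invmx P) *m ('X%:M - map_mx polyC (diag_mx d)) *m map_mx polyC P.
    by rewrite mulmxBr mulmxBl scalar_mxC -['X%:M *m _ *m _]mulmxA PP mulmx1.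
  rewrite !det_mulmx mulrC mulrA -det_mulmx (mulmx1C PP) det1 mul1r.
  rewrite map_diag_mx -diag_const_mx -raddfB/= det_diag; apply: eq_bigr => i _.
  by rewrite !mxE rmorphB/= map_polyX map_polyC/= -dE.
move=> w; rewrite -/B {1}BE.
have -> : 1%:M + w *: (invmx P *m diag_mx d *m P) = invmx P *m (1%:M + w *: diag_mx d) *m P.
  by rewrite mulmxDr mulmxDl mulmx1 mulVmx// -scalemxAr -scalemxAl.
rewrite det_conj// -diag_const_mx -linearZ/= -raddfD/= det_diag /s big_image/=.
by apply: eq_bigr => i _; rewrite !mxE -dE.
Qed.

Lemma sum_roots_mup (R : realType) (s : seq R) (f : R -> R) :
  let p := \prod_(a <- s) ('X - a%:P) in
  \sum_(x <- rootsR p) f x *+ mup x p = \sum_(a <- s) f a.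
Proof.
move=> p; have p0 : p != 0 by rewrite monic_neq0// monic_prod_XsubC.
have perm : perm_eq (rootsR p) (undup s).
  apply: uniq_perm; rewrite ?undup_uniq ?uniq_roots// => x.
  by rewrite -(roots_on_rootsR p0) mem_undup /p root_prod_XsubC in_itv.
rewrite (perm_big _ perm)/= -[RHS]big_undup_iterop_count/=.
apply: eq_bigr => x _; rewrite /p mu_prod_XsubC.
by [].
Qed.

(* Both square roots [w] of [- y] give [prod (1 + w a) = mpol t y], whence
   [prod (1 + a^2 y) = (mpol t y)^2]. *)
Lemma energy_sqprod (R : realType) (V : finType) (e : rel V) t r :
  symmetric e -> irreflexive e -> realizes e t setT r ->
  exists l : seq R, [/\ all (Num.le 0) l, \sum_(a <- l) a = energy e R &
    forall y, 0 < y -> sqprod l y = mpol t y ^+ 2].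
Proof.
move=> symE irrE H.
have [|s [sp sd]] := @symmetric_spectrum R _ (adjacency e R).
  by apply/matrixP => i j; rewrite !mxE symE.
exists [seq `|a| | a <- s]; split.
- by apply/allP => _ /mapP[a _ ->]; exact: normr_ge0.
- by rewrite big_map /energy sp sum_roots_mup.
move=> y y0; apply: (@complexI R).
pose w : R[i] := real_complex R (Num.sqrt y) * 'i%C.
have w2 : w ^+ 2 = - real_complex R y.
  by rewrite exprMn sqr_i mulrN1 -rmorphXn/= sqr_sqrtr// ltW.
have y0' : 0 < real_complex R y by rewrite ltcR.
have mapA : map_mx (real_complex R) (adjacency e R) = adjacency e R[i].
  by apply/matrixP => i j; rewrite !mxE rmorph_nat.
have h1 := det_adjacency symE irrE H y0' w2.
have h2 : \det (1%:M + (- w) *: adjacency e R[i]) = mpol t (real_complex R y).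
  by apply: (det_adjacency symE irrE H y0'); rewrite sqrrN.
rewrite rmorphXn/= -(mpol_morph (real_complex R) t y).1 expr2 -{1}h1 -h2 -mapA !sd.
rewrite -big_split/= /sqprod big_map rmorph_prod/=; apply: eq_bigr => a _.
rewrite real_normK ?num_real// rmorphD rmorph1 rmorphM rmorphXn/=.
rewrite -[real_complex R y]opprK -w2; ring.
Qed.

Local Close Scope ring_scope.

(** * The class of trees and its two candidates *)

Section TreeOfRealization.
Variables (V : finType) (e : rel V).
Hypotheses (symE : symmetric e) (irrE : irreflexive e).

(** A neighbour that is not deeper can only be the parent, so both neighbours of a deepest vertex on
    a cycle would be its parent. *)
Lemma realizes_tree t r : realizes e t setT r -> tree e.
Proof.
move=> H; have [par [dep [_ [He Hp _ _ _]]]] := realizes_parent symE irrE (@ltr01 rat) H.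
have adj x z : e x z -> (dep z <= dep x)%N -> z = par x.
  rewrite He ?inE// => /orP[] /andP[nr /eqP <-]//.
  by have [_] := Hp z (in_setT z) nr; rewrite ltnNge => /negP.
split; first by split.
- by apply/card_gt0P; exists r.
- have conn n x : (dep x < n)%N -> connect e x r.
    elim: n x => // n IH x dx; have [->//|xr] := eqVneq x r.
    have [_ dp] := Hp x (in_setT x) xr.
    apply: connect_trans (IH (par x) _); last by lia.
    by apply: connect1; rewrite symE He ?inE// /child_of xr eqxx.
  move=> x y; apply: connect_trans (conn _ x (ltnSn _)) _.
  by rewrite (sym_connect_sym symE); exact: conn (ltnSn _).
move=> c uc; rewrite leqNgt; apply/negP => sc.
have [x xc xmax] : exists2 x, x \in c & forall z, z \in c -> (dep z <= dep x)%N.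
  have x0c : nth r c 0 \in c by rewrite mem_nth// (ltn_trans _ sc).
  have [x xc xm] := @arg_maxnP _ (nth r c 0) (mem c) dep x0c.
  by exists x.
have [i p Ep] := rot_to xc.
have : ucycle e (x :: p) by rewrite -Ep rot_ucycle.
have memp z : z \in x :: p -> (dep z <= dep x)%N by rewrite -Ep mem_rot => /xmax.
have : (size p > 1)%N by have := congr1 size Ep; rewrite size_rot /=; lia.
case: p memp {Ep} => // y p memp; case/lastP: p memp => // p z memp _.
rewrite /ucycle /= -rcons_cons !rcons_path last_rcons => /andP[/andP[xy /andP[_ zx]]].
move=> /andP[_ /andP[yp _]].
have ey := adj _ _ xy (memp y (mem_behead (s := x :: y :: rcons p z) (mem_head _ _))).
have zm : z \in x :: y :: rcons p z by rewrite !inE mem_rcons mem_head !orbT.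
rewrite symE in zx; have ez := adj _ _ zx (memp z zm).
by move: yp; rewrite ey -ez mem_rcons mem_head.
Qed.

Lemma two_max_treeP n t r : realizes e t setT r ->
  (two_max_tree e n 4 <-> [/\ order t = n, sum_degree (fun d => 4 < d) t = 0
     & sum_degree (eq_op 4) t = 2])%N.
Proof.
move=> H; rewrite -!(sum_degreeP symE irrE _ H) -(realizes_card symE irrE H).
have -> : (\sum_x (4 == degree e x))%N = #|[set x | degree e x == 4]|.
  by rewrite -sum1dep_card [RHS]big_mkcond; apply: eq_bigr => x _; rewrite eq_sym; case: eqP.
split=> [[_ -> m c]|[n_ m c]]; split=> //.
- apply/eqP; rewrite sum_nat_eq0; apply/forallP => x; apply/implyP => _.
  by rewrite eqb0 -leqNgt -m /max_degree leq_bigmax.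
- exact: realizes_tree H.
apply/eqP; rewrite eqn_leq; apply/andP; split.
  apply/bigmax_leqP => x _; rewrite leqNgt; apply/negP => x4.
  by move/eqP: m; rewrite sum_nat_eq0 => /forallP/(_ x)/implyP/(_ isT); rewrite x4.
have /card_gt0P[x] : (0 < #|[set x | degree e x == 4]|)%N by rewrite c.
by rewrite inE => /eqP <-; rewrite /max_degree leq_bigmax.
Qed.

End TreeOfRealization.

(* [path_tree k] has [k + 1] vertices. *)
Fixpoint path_tree k : rtree := if k is k'.+1 then Graft Root (path_tree k') else Root.

Definition pendants k : rtree := iter k (fun t => Graft t (path_tree 1)) Root.

Fixpoint path_P2_tree (c : nat -> nat) i k : rtree :=
  if k is k'.+1 then Graft (pendants (c i)) (path_P2_tree c i.+1 k') else pendants (c i).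

Section PathP2.
Variables (m : nat) (c : nat -> nat).
Local Notation V := (path_P2_vertex m c).
Local Notation E := (path_P2 m c).

Lemma path_P2_sym : symmetric E.
Proof. by move=> u v; rewrite /path_P2 orbC. Qed.

Lemma path_P2_irr : irreflexive E.
Proof.
move=> [i|[p []]]; rewrite /path_P2 //= ?orbb //.
by apply/negbTE; rewrite neq_ltn ltnSn.
Qed.

Definition path_P2_index (v : V) : nat := match v with inl j => j | inr (p, _) => tag p end.

Lemma eq_tagged_ord (p q : {i : 'I_m & 'I_(c i)}) :
  (p == q) = (tag p == tag q) && (tagged p == tagged q :> nat).
Proof.
case: p q => [i a] [j b] /=; apply/eqP/andP => [[ij]|[/eqP ij]].
  by case: j / ij b => b /eqP; rewrite eq_Tagged/= => /eqP ->; rewrite !eqxx.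
by case: j / ij b => b /eqP ab; congr existT; apply/val_inj.
Qed.

Lemma realizes_pendants (i : 'I_m) k : k <= c i ->
  realizes E (pendants k) [set v : V | match v with inl j => j == i
     | inr (p, _) => (tag p == i) && (tagged p < k) end] (inl i).
Proof.
elim: k => [|k IH] kc.
  by apply/setP => -[j|[p b]]; rewrite !inE ?andbF.
pose p : {i : 'I_m & 'I_(c i)} := Tagged (fun i : 'I_m => 'I_(c i)) (Ordinal kc).
exists [set v : V | match v with inl j => j == i
     | inr (p, _) => (tag p == i) && (tagged p < k) end], [set inr (p, false); inr (p, true)],
  (inr (p, false)); split.
- apply/setP => -[j|[q b]]; rewrite !inE ?orbF //.
  rewrite ltnS leq_eqVlt andb_orr orbC; congr orb.
  have -> : (inr (q, b) == inr (p, false) :> V) || (inr (q, b) == inr (p, true) :> V) = (q == p).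
    by apply/orP/eqP => [[] /eqP [->]//|->]; case: b; [right|left].
  by rewrite eq_tagged_ord.
- rewrite -setI_eq0; apply/eqP/setP => -[j|[q b]]; rewrite !inE ?andbF//.
  apply/negP => /andP[/andP[_ qk]].
  by case/orP => /eqP [qp _]; move: qk; rewrite qp /= ltnn.
- exact: IH (ltnW kc).
- exists [set inr (p, false)], [set inr (p, true)], (inr (p, true)); split => //.
    by rewrite disjoints1 inE; apply/eqP => -[].
  by move=> x y; rewrite !inE => /eqP -> /eqP ->; rewrite /path_P2 /= !eqxx.
move=> [j|[q b]] y; rewrite !inE.
  move=> /eqP -> /orP[] /eqP ->; rewrite /path_P2 /= ?orbF ?eqxx //.
  by apply/esym/negbTE; apply/eqP => -[].
move=> /andP[_ qk]; have qp : q == p = false.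
  by apply: contraTF qk => /eqP ->; rewrite /= ltnn.
by move=> /orP[] /eqP ->; rewrite /path_P2 /=; case: b; rewrite ?[p == q]eq_sym ?qp.
Qed.

Lemma realizes_path_P2_from i k (im : i < m) : i + k.+1 = m ->
  realizes E (path_P2_tree c i k) [set v : V | i <= path_P2_index v] (inl (Ordinal im)).
Proof.
elim: k i im => [|k IH] i im ik /=.
  have -> : [set v : V | i <= path_P2_index v] = [set v : V | match v with inl j => j == Ordinal im
     | inr (p, _) => (tag p == Ordinal im) && (tagged p < c i) end].
    have eqi (j : 'I_m) : (i <= j) = (j == Ordinal im).
      by rewrite -val_eqE /=; have := ltn_ord j; lia.
    apply/setP => -[j|[p b]]; rewrite !inE /= eqi//.
    case: eqP => //= tp; have := ltn_ord (tagged p).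
    by move: (nat_of_ord (tagged p)) => q; rewrite tp => ->.
  exact: (realizes_pendants (i := Ordinal im)).
have im1 : i.+1 < m by lia.
exists [set v : V | match v with inl j => j == Ordinal im
     | inr (p, _) => (tag p == Ordinal im) && (tagged p < c i) end],
  [set v : V | i < path_P2_index v], (inl (Ordinal im1)).
have eqi (j : 'I_m) : (i <= j) = (j == Ordinal im) || (i < j).
  by rewrite -val_eqE /= leq_eqVlt eq_sym.
split.
- apply/setP => -[j|[p b]]; rewrite !inE /= eqi//.
  congr orb; case: eqP => //= tp; have := ltn_ord (tagged p).
  by move: (nat_of_ord (tagged p)) => q; rewrite tp => ->.
- rewrite -setI_eq0; apply/eqP/setP => -[j|[p b]]; rewrite !inE //=.
    by case: eqP => // ->; rewrite /= ltnn.
  case: eqP => // tp; have -> : i < tag p = false by rewrite tp /= ltnn.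
  by rewrite andbF.
- exact: (realizes_pendants (i := Ordinal im)).
- by apply: IH; lia.
move=> [j|[p b]] [l|[q d]]; rewrite !inE /path_P2 /=.
- move=> /eqP -> il; have -> : (inl l == inl (Ordinal im1) :> V) = (l == i.+1 :> nat) by [].
  rewrite eqxx /= orbC; have -> // : (i == l.+1 :> nat) = false.
  by apply/negbTE; rewrite neq_ltn (ltn_trans il).
- move=> /eqP -> il; case: d; rewrite ?andbF// orbF; apply/negbTE.
  by apply: contraTneq il => ->; rewrite /= ltnn.
- move=> /andP[/eqP tp _] il; case: b; rewrite ?andbF// /= tp; apply/negbTE.
  by apply: contraTneq il => <-; rewrite /= ltnn.
move=> /andP[/eqP tp _] il.
have pq : p == q = false by apply: contraTF il => /eqP <-; rewrite tp /= ltnn.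
by case: b; case: d => //=; rewrite ?pq ?[q == p]eq_sym ?pq.
Qed.

Lemma realizes_path_P2 k : m = k.+1 ->
  exists r, realizes E (path_P2_tree c 0 k) setT r.
Proof.
move=> mk; have m0 : 0 < m by rewrite mk.
exists (inl (Ordinal m0)); have := @realizes_path_P2_from 0 k m0 (esym mk).
by congr realizes; apply/setP => v; rewrite !inE.
Qed.

End PathP2.

(** * Reduction to two branching vertices with pendent paths *)

Local Open Scope ring_scope.

(* [pathp y k] is the matching polynomial of the path on [k] vertices. *)
Fixpoint pathp_pair (R : pzRingType) (y : R) k : R * R :=
  if k is k'.+1 then let: (a, b) := pathp_pair y k' in (b, b + y * a) else (1, 1).

Definition pathp (R : pzRingType) (y : R) k : R := (pathp_pair y k).1.

Lemma pathpSS (R : pzRingType) (y : R) k : pathp y k.+2 = pathp y k.+1 + y * pathp y k.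
Proof. by rewrite /pathp /=; case: pathp_pair. Qed.

Local Notation gt4 := (fun d => nat_of_bool (4 < d)%N).
Local Notation eq4 := (fun d => nat_of_bool (4 == d)%N).

Section Domination.
Variable R : realType.
Implicit Types (t s : rtree) (y : R).

Lemma pathp_gt0 y k : 0 < y -> 0 < pathp y k /\ 0 < pathp y k.+1.
Proof.
move=> y0; elim: k => [|k [a b]]; first by rewrite /pathp /=; split; exact: ltr01.
by split=> //; rewrite pathpSS addr_gt0// mulr_gt0.
Qed.

Lemma pathp_le y k : 0 < y -> pathp y k <= pathp y k.+1.
Proof.
move=> y0; case: k => [|k]; first by rewrite /pathp /=.
by rewrite pathpSS lerDl mulr_ge0 ?ltW// (pathp_gt0 k y0).1.
Qed.

Lemma mpol_path_tree y k :
  mpol (path_tree k) y = pathp y k.+1 /\ mdel (path_tree k) y = pathp y k.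
Proof.
elim: k => [|k [a b]] //=.
by rewrite mpol_graft mdel_graft a b !mul1r pathpSS.
Qed.

Lemma order_path_tree k : order (path_tree k) = k.+1.
Proof. by elim: k => // k IH; rewrite [path_tree _]/= order_graft IH. Qed.

Lemma mpol_iter_root y t n :
  mpol (iter n.+1 (Graft Root) t) y = pathp y n.+1 * mpol t y + y * (pathp y n * mdel t y) /\
  mdel (iter n.+1 (Graft Root) t) y = mpol (iter n (Graft Root) t) y.
Proof.
split; last by rewrite iterS mdel_graft mul1r.
elim/ltn_ind: n => -[|[|n]] IH.
- by rewrite /= mpol_graft /pathp /= !mul1r.
- rewrite !iterS !(mpol_graft, mdel_graft) !mul1r pathpSS /pathp /=; ring.
rewrite iterS mpol_graft iterS mdel_graft -iterS !mul1r !IH//.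
by rewrite !(pathpSS y n.+1) (pathpSS y n); ring.
Qed.

(* Isomorphism of rooted trees, seen through their realizations. Equality of the
   polynomials is carried along to avoid building a realization of [t]. *)
Definition same_tree t t' :=
  (forall (V : finType) (e : rel V), symmetric e ->
    forall S r, realizes e t S r -> realizes e t' S r) /\
  (forall y : R, mpol t y = mpol t' y /\ mdel t y = mdel t' y).

(** Strictness may sit in either component: moving the root of a path from an inner vertex to an end
    leaves [mpol] unchanged and raises only [mdel]. *)
Definition dominated t t' := forall y : R, 0 < y ->
  [/\ mpol t y <= mpol t' y, mdel t y <= mdel t' y &
      mpol t y < mpol t' y \/ mdel t y < mdel t' y].

Definition below t t' := same_tree t t' \/ dominated t t'.

Lemma same_tree_refl t : same_tree t t. Proof. by []. Qed.

Lemma same_tree_trans t t' t'' : same_tree t t' -> same_tree t' t'' -> same_tree t t''.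
Proof.
move=> [h1 m1] [h2 m2]; split=> [V e se S r /h1|y]; first by move/(_ se)/h2; apply.
by rewrite (m1 y).1 (m1 y).2.
Qed.

Lemma same_tree_graft t t' s s' : same_tree t t' -> same_tree s s' ->
  same_tree (Graft t s) (Graft t' s').
Proof.
move=> [h1 m1] [h2 m2]; split=> [V e se S r|y].
  by apply: realizes_graft_sub => ? ?; [exact: h1|exact: h2].
by rewrite !mpol_graft !mdel_graft (m1 y).1 (m1 y).2 (m2 y).1 (m2 y).2.
Qed.

Lemma same_tree_swap t a b : same_tree (Graft (Graft t a) b) (Graft (Graft t b) a).
Proof.
split=> [V e se S r|y]; first exact: realizes_swap.
by rewrite !(mpol_graft, mdel_graft); split; ring.
Qed.

Lemma below_refl t : below t t. Proof. by left. Qed.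

Lemma below_weak t t' y : below t t' -> 0 < y ->
  mpol t y <= mpol t' y /\ mdel t y <= mdel t' y.
Proof.
by move=> [[_ h]|h] y0; [rewrite (h y).1 (h y).2|case: (h y y0)].
Qed.

Lemma below_trans t t' t'' : below t t' -> below t' t'' -> below t t''.
Proof.
move=> h1 h2; case: (h1) => [s1|d1]; last first.
  right=> y y0; have [a b] := below_weak h2 y0; have [c d st] := d1 y y0.
  split; [exact: le_trans c a|exact: le_trans d b|].
  by case: st => st; [left; exact: lt_le_trans st a|right; exact: lt_le_trans st b].
case: h2 => [s2|d2]; first by left; exact: same_tree_trans s1 s2.
by right=> y y0; rewrite (s1.2 y).1 (s1.2 y).2; exact: d2.
Qed.

(** Both components enter [mpol] of the joined tree with positive coefficients, so strictness in
    either of them becomes strictness in [mpol]. *)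
Lemma below_graft_lt t t' s s' : below t t' -> below s s' ->
  same_tree (Graft t s) (Graft t' s') \/
  forall y : R, 0 < y -> mpol (Graft t s) y < mpol (Graft t' s') y /\
    mdel (Graft t s) y <= mdel (Graft t' s') y.
Proof.
move=> h1 h2.
case: (h1) => [s1|d1]; first case: (h2) => [s2|d2]; first by left; exact: same_tree_graft.
  right=> y y0; have [a b st] := d2 y y0; have [t0 t0'] := mpol_gt0 t y0.
  rewrite !(mpol_graft, mdel_graft) -(s1.2 y).1 -(s1.2 y).2.
  split; last by rewrite ler_pM2l.
  case: st => st; first by rewrite ltr_leD// ?ltr_pM2l// !ler_pM2l.
  by rewrite ler_ltD// ?ler_pM2l// !ltr_pM2l.
right=> y y0; have [a b st] := d1 y y0; have [c d] := below_weak h2 y0.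
have [t0 t0'] := mpol_gt0 t y0; have [s0 s0'] := mpol_gt0 s y0.
have [r0 r0'] := mpol_gt0 t' y0; have [q0 q0'] := mpol_gt0 s' y0.
have e1 : mpol t y * mpol s y <= mpol t' y * mpol s' y by apply: ler_pM => //; exact: ltW.
have e2 : y * (mdel t y * mdel s y) <= y * (mdel t' y * mdel s' y).
  by rewrite ler_pM2l//; apply: ler_pM => //; exact: ltW.
rewrite !(mpol_graft, mdel_graft); split; last by apply: ler_pM => //; exact: ltW.
case: st => st.
  rewrite ltr_leD//; apply: (@lt_le_trans _ _ (mpol t' y * mpol s y)).
    by rewrite ltr_pM2r.
  by rewrite ler_pM2l.
rewrite ler_ltD// ltr_pM2l//; apply: (@lt_le_trans _ _ (mdel t' y * mdel s y)).
  by rewrite ltr_pM2r.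
by rewrite ler_pM2l.
Qed.

Lemma below_graft t t' s s' : below t t' -> below s s' -> below (Graft t s) (Graft t' s').
Proof.
move=> h1 h2; case: (below_graft_lt h1 h2) => [h|h]; first by left.
by right=> y /h[a b]; split; [exact: ltW| |left].
Qed.

(** The recurrence of matching polynomials along a growing path; [pathp], [spine_seq] and
    [Tb_factor] satisfy it. For y > 0 its solutions are monotone in two consecutive values. *)
Definition path_rec y (X : nat -> R) := forall n, X n.+2 = X n.+1 + y * X n.

Lemma path_rec_add y X n k : path_rec y X ->
  X (n + k).+2 = pathp y k.+1 * X n.+1 + y * (pathp y k * X n).
Proof.
move=> rX; elim/ltn_ind: k => -[|[|k]] IH.
- by rewrite addn0 rX /pathp /= !mul1r.
- by rewrite addn1 !rX pathpSS /pathp /=; ring.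
have h1 := IH k.+1 (ltnSn _); have h0 := IH k (ltnW (ltnSn _)).
by rewrite !addnS in h1 *; rewrite rX h1 h0 !(pathpSS y k.+1) !(pathpSS y k); ring.
Qed.

Lemma pathp_add y k n :
  pathp y (n + k).+2 = pathp y k.+1 * pathp y n.+1 + y * (pathp y k * pathp y n).
Proof. exact: (path_rec_add n k (pathpSS y)). Qed.

(** Both sides are the same path. On the right its root is an end, whose removal does not cut the
    path, so [mdel] is larger unless a = 0. *)
Lemma graft_paths a b : below (Graft (path_tree a) (path_tree b)) (path_tree (b + a).+1).
Proof.
case: a => [|a]; first by rewrite addn0; left.
right=> y y0; rewrite (mpol_graft (path_tree a.+1)) (mdel_graft (path_tree a.+1)).
have [-> ->] := mpol_path_tree y a.+1; have [-> ->] := mpol_path_tree y b.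
have [-> ->] := mpol_path_tree y (b + a.+1).+1.
rewrite (pathp_add y a.+1 b) addnS (pathp_add y a b).
have := mulr_gt0 y0 (mulr_gt0 (pathp_gt0 a y0).1 (pathp_gt0 b y0).1).
rewrite !pathpSS; split; [|lra|right; lra].
rewrite -subr_ge0 [X in 0 <= X](_ : _ = 0)//; ring.
Qed.

Lemma below_path s : below s (path_tree (order s).-1).
Proof.
elim: s => [|t IHt s IHs]; first exact: below_refl.
apply: below_trans (below_graft IHt IHs) _.
rewrite order_graft; have := graft_paths (order t).-1 (order s).-1.
by rewrite (_ : ((order s).-1 + (order t).-1).+1 = (order t + order s).-1)//; rewrite /order; lia.
Qed.

(* An entry [k] stands for a pendent path with [k + 1] vertices, a P_2 being
   [k = 1]. In [bispider bs c ks] the two centres are at distance [c + 1]. *)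
Definition node (ks : seq nat) : rtree := foldr (fun k t => Graft t (path_tree k)) Root ks.

Definition spine c (ks : seq nat) : rtree := iter c (Graft Root) (node ks).

Definition bispider bs c ks : rtree := Graft (node bs) (spine c ks).

Lemma order_node ks : order (node ks) = (sumn ks + size ks).+1.
Proof.
by elim: ks => //= k ks IH; rewrite order_graft IH order_path_tree; lia.
Qed.

Lemma order_spine c ks : order (spine c ks) = (c + sumn ks + size ks).+1.
Proof.
rewrite /spine; elim: c => [|c IH]; first by rewrite order_node.
by rewrite iterS order_graft IH.
Qed.

(** The root of a branch also has a parent, hence the successor. *)
Definition sum_branch (F : nat -> nat) t := (F (nchild t).+1 + sum_nonroot F t)%N.

Lemma nchild0 t : nchild t = 0%N -> t = Root. Proof. by case: t. Qed.

Lemma nchildS t k : nchild t = k.+1 -> exists t' s, t = Graft t' s /\ nchild t' = k.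
Proof. by case: t => // t s [<-]; exists t, s. Qed.

(* A pendent path attached inside the path between the two centres may be
   inserted into that path. *)
Lemma below_insert q t : below (Graft (Graft Root (path_tree q)) t) (iter q.+2 (Graft Root) t).
Proof.
right=> y y0; have [-> ->] := mpol_iter_root y t q.+1.
have [-> _] := mpol_iter_root y t q.
rewrite !(mpol_graft, mdel_graft).
have [-> ->] := mpol_path_tree y q; rewrite [mpol Root y]/mpol [mdel Root y]/mdel /= pathpSS.
have [t0 t0'] := mpol_gt0 t y0; have := mulr_gt0 y0 (mulr_gt0 (pathp_gt0 q y0).1 t0').
(* The two trees differ only in the position of the root: [mpol] is the same and [mdel] grows. *)
by move=> h; split; [rewrite -subr_ge0 [X in 0 <= X](_ : _ = 0)//; ring|lra|right; lra].
Qed.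

(** Walk towards the centre. A root with one child prolongs the spine; with two children, the one
    away from the centre is straightened and inserted into the spine; with three children the root
    is the centre. *)
Lemma below_spine s : sum_branch gt4 s = 0%N -> sum_branch eq4 s = 1%N ->
  exists c ks, [/\ size ks = 3%N, order s = order (spine c ks) & below s (spine c ks)].
Proof.
move: {2}(order s) (leqnn (order s)) => n; elim: n s => // n IH s sn.
rewrite /sum_branch => hlt heq.
have ords a b : order (Graft a b) = (order a + order b)%N := order_graft a b.
have oR : order Root = 1%N by [].
have : (nchild s <= 3)%N by move: hlt; case: ltnP => //; lia.
case En : (nchild s) => [|[|[|[|//]]]] _.
- by move: heq; rewrite (nchild0 En).
- have [t' [u [Es /nchild0 Et]]] := nchildS En; subst t' s.
  have [|||c [ks [sk ok bk]]] := IH u _ _ _.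
  + by move: sn; rewrite ords oR; lia.
  + by move: hlt; rewrite /sum_branch /=; lia.
  + by move: heq; rewrite /sum_branch /=; lia.
  exists c.+1, ks; split=> //; first by rewrite ords ok /spine iterS ords.
  by rewrite /spine iterS; apply: below_graft bk; exact: below_refl.
- have [t' [u2 [Es /nchildS[t'' [u1 [Et /nchild0 Et']]]]]] := nchildS En; subst t'' t' s.
  have key a b : (order (Graft (Graft Root a) b) <= n.+1)%N -> sum_branch gt4 b = 0%N ->
     sum_branch eq4 b = 1%N ->
     exists c ks, [/\ size ks = 3%N, order (Graft (Graft Root a) b) = order (spine c ks) &
       below (Graft (Graft Root a) b) (spine c ks)].
    move=> ob h1 h2; have [|c [ks [sk ok bk]]] := IH b _ h1 h2.
      by move: ob; rewrite !ords oR; lia.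
    exists ((order a).+1 + c)%N, ks; split=> //.
      by rewrite [RHS]order_spine !ords oR ok order_spine; lia.
    have := below_insert (order a).-1 (spine c ks).
    rewrite /spine iterD (_ : (order a).-1.+2 = (order a).+1)//.
    apply: below_trans; apply: below_graft bk.
    by apply: below_graft (below_path a); exact: below_refl.
  move: hlt heq sn; rewrite /= -!/(sum_branch _ _) => hlt heq sn.
  have [hb|hb] : sum_branch eq4 u2 = 1%N \/ sum_branch eq4 u1 = 1%N.
    by move: heq; rewrite /sum_branch; lia.
    apply: key => //; by move: hlt; rewrite /sum_branch; lia.
  have [||c [ks [sk ok bk]]] := key u2 u1 _ _ hb.
  + by move: sn; rewrite !ords; lia.
  + by move: hlt; rewrite /sum_branch; lia.
  exists c, ks; split=> //; first by rewrite -ok !ords; lia.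
  by apply: below_trans bk; left; exact: same_tree_swap.
have [t1 [u1 [Es /nchildS[t2 [u2 [Et /nchildS[t3 [u3 [Et' /nchild0 Et'']]]]]]]]] := nchildS En.
subst t3 t2 t1 s; exists 0%N, [:: (order u1).-1; (order u2).-1; (order u3).-1]; split=> //.
  by rewrite [RHS]order_spine !ords oR /order /=; lia.
rewrite /spine /=; do 3!apply: below_graft (below_path _).
exact: below_refl.
Qed.

Definition mpol_lt t t' := forall y : R, 0 < y -> mpol t y < mpol t' y.

Lemma below_bispider t : nchild t = 4%N -> sum_nonroot gt4 t = 0%N ->
  sum_nonroot eq4 t = 1%N ->
  exists bs c ks, [/\ size bs = 3%N, size ks = 3%N, order t = order (bispider bs c ks) &
    same_tree t (bispider bs c ks) \/ mpol_lt t (bispider bs c ks)].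
Proof.
move=> /nchildS[t1 [u1 [-> /nchildS[t2 [u2 [-> /nchildS[t3 [u3 [-> /nchildS[t4 [u4 [-> /nchild0 ->]]]]]]]]]]]].
rewrite /= !add0n => hlt heq.
have key a b c d : sum_branch gt4 d = 0%N -> sum_branch eq4 d = 1%N ->
  exists bs i ks, [/\ size bs = 3%N, size ks = 3%N,
    order (Graft (Graft (Graft (Graft Root a) b) c) d) = order (bispider bs i ks) &
    same_tree (Graft (Graft (Graft (Graft Root a) b) c) d) (bispider bs i ks) \/
    mpol_lt (Graft (Graft (Graft (Graft Root a) b) c) d) (bispider bs i ks)].
  move=> h1 h2; have [i [ks [sk ok bk]]] := below_spine h1 h2.
  exists [:: (order c).-1; (order b).-1; (order a).-1], i, ks; split=> //.
    by rewrite [RHS]order_graft order_node -ok !order_graft /order /=; lia.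
  have bn : below (Graft (Graft (Graft Root a) b) c)
      (node [:: (order c).-1; (order b).-1; (order a).-1]).
    by do 3!apply: below_graft (below_path _); exact: below_refl.
  by case: (below_graft_lt bn bk) => [h|h]; [left|right=> y /h[]].
have cases : [\/ sum_branch eq4 u1 = 1%N, sum_branch eq4 u2 = 1%N,
   sum_branch eq4 u3 = 1%N | sum_branch eq4 u4 = 1%N].
  move: heq; rewrite /sum_branch => heq.
  have [h|h] : (sum_branch eq4 u1 = 1%N \/ sum_branch eq4 u2 = 1%N) \/
    (sum_branch eq4 u3 = 1%N \/ sum_branch eq4 u4 = 1%N)
    by rewrite /sum_branch; lia.
    by case: h => h; [exact: Or41|exact: Or42].
  by case: h => h; [exact: Or43|exact: Or44].
(* Swaps bring the branch that contains the other centre into the last position. *)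
have fin a b c d : sum_branch gt4 d = 0%N -> sum_branch eq4 d = 1%N ->
   order (Graft (Graft (Graft (Graft Root u4) u3) u2) u1) =
   order (Graft (Graft (Graft (Graft Root a) b) c) d) ->
   same_tree (Graft (Graft (Graft (Graft Root u4) u3) u2) u1)
     (Graft (Graft (Graft (Graft Root a) b) c) d) ->
   exists bs i ks, [/\ size bs = 3%N, size ks = 3%N,
    order (Graft (Graft (Graft (Graft Root u4) u3) u2) u1) = order (bispider bs i ks) &
    same_tree (Graft (Graft (Graft (Graft Root u4) u3) u2) u1) (bispider bs i ks) \/
    mpol_lt (Graft (Graft (Graft (Graft Root u4) u3) u2) u1) (bispider bs i ks)].
  move=> h1 h2 -> st; have [bs [i [ks [s1 s2 o b']]]] := key a b c d h1 h2.
  exists bs, i, ks; split=> //; case: b' => [b'|b']; first by left; exact: same_tree_trans st b'.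
  by right=> y y0; rewrite (st.2 y).1; exact: b'.
have sw := same_tree_swap; have rf := same_tree_refl.
case: cases => h.
- by apply: (fin u4 u3 u2 u1) => //; move: hlt; rewrite /sum_branch; lia.
- apply: (fin u4 u3 u1 u2) => //; first by move: hlt; rewrite /sum_branch; lia.
  by rewrite !order_graft; lia.
- apply: (fin u4 u2 u1 u3) => //; first by move: hlt; rewrite /sum_branch; lia.
    by rewrite !order_graft; lia.
  by apply: same_tree_trans (sw _ _ _); apply: same_tree_graft => //.
- apply: (fin u3 u2 u1 u4) => //; first by move: hlt; rewrite /sum_branch; lia.
    by rewrite !order_graft; lia.
  apply: same_tree_trans (sw _ _ _); apply: same_tree_graft => //.
  apply: same_tree_trans (sw _ _ _); apply: same_tree_graft => //.
Qed.

End Domination.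

(** * Exchanges between pendent paths and the spine *)

Section Steps.
Variable R : realType.
Implicit Types (t s : rtree) (y : R) (l bs ks : seq nat).
Local Notation mpol_lt := (mpol_lt R).

(** A long path is cut to P_2 and the sequence X absorbs the rest. Both sides obey the recurrence in
    j; the hypothesis is the case j = 0, and for j = -1 there is equality. *)
Lemma path_rec_exchange y X a : path_rec y X -> 0 < y ->
  pathp y 3 * X a < pathp y 2 * X a.+1 ->
  forall j, pathp y j.+3 * X a < pathp y 2 * X (a + j.+1)%N.
Proof.
move=> rX y0 h; suff H j : pathp y j.+3 * X a < pathp y 2 * X (a + j.+1)%N /\
    pathp y j.+2 * X a <= pathp y 2 * X (a + j)%N by move=> j; exact: (H j).1.
elim: j => [|j [h1 h2]]; first by rewrite addn1 addn0.
split; last exact: ltW.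
rewrite (pathpSS y j.+2) !addnS rX -addnS mulrDl mulrDr ltr_leD//.
by rewrite -mulrA [X in _ <= X]mulrCA ler_pM2l.
Qed.

(* Shifted by one, so that the value at 0 belongs to the node without its
   centre. *)
Definition spine_seq ks y n : R :=
  if n is n'.+1 then mpol (spine n' ks) y else mdel (node ks) y.

Lemma spine_seqE ks y c : mpol (spine c ks) y = spine_seq ks y c.+1 /\
  mdel (spine c ks) y = spine_seq ks y c.
Proof. by split=> //; case: c => // c; rewrite /spine iterS mdel_graft mul1r. Qed.

Lemma spine_seq_rec ks y : path_rec y (spine_seq ks y).
Proof.
move=> n; rewrite -(spine_seqE ks y n.+1).1 /spine iterS mpol_graft !mul1r.
by rewrite (spine_seqE ks y n).1 (spine_seqE ks y n).2.
Qed.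

Lemma mdel_le_mpol t y : 0 < y -> mdel t y <= mpol t y.
Proof.
move=> y0; elim: t => [|t IH s _]; first by rewrite /mdel /mpol.
have [t0 t0'] := mpol_gt0 t y0; have [s0 s0'] := mpol_gt0 s y0.
rewrite mpol_graft mdel_graft (@le_trans _ _ (mpol t y * mpol s y))//.
  by rewrite ler_pM2r.
by rewrite lerDl !mulr_ge0 ?ltW.
Qed.

Lemma mdel_lt_mpol t s y : 0 < y -> mdel (Graft t s) y < mpol (Graft t s) y.
Proof.
move=> y0; have [t0 t0'] := mpol_gt0 t y0; have [s0 s0'] := mpol_gt0 s y0.
rewrite mpol_graft mdel_graft (@le_lt_trans _ _ (mpol t y * mpol s y))//.
  by rewrite ler_pM2r// mdel_le_mpol.
by rewrite ltrDl !mulr_gt0.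
Qed.

Lemma spine_seq_gt0 ks y n : 0 < y -> 0 < spine_seq ks y n.
Proof.
by move=> y0; case: n => [|n] /=; [exact: (mpol_gt0 _ y0).2|exact: (mpol_gt0 _ y0).1].
Qed.

Lemma spine_seq_lt k ks y n : 0 < y -> spine_seq (k :: ks) y n < spine_seq (k :: ks) y n.+1.
Proof.
move=> y0; case: n => [|n]; first exact: mdel_lt_mpol.
by rewrite [X in _ < X]spine_seq_rec ltrDl mulr_gt0 // spine_seq_gt0.
Qed.

(** Matchings of t that cover its root, of total weight [mpol t y - mdel t y], separate the path
    from s; for the others the path, the root and s form one longer spine. With c + k fixed, only
    the product in the first summand varies. *)
Lemma mpol_branch t y k (X : nat -> R) c s : path_rec y X ->
  mpol s y = X c.+1 -> mdel s y = X c ->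
  mpol (Graft (Graft t (path_tree k)) s) y =
    (mpol t y - mdel t y) * (pathp y k.+1 * X c.+1) + mdel t y * X (c + k).+3.
Proof.
move=> rX e1 e2; rewrite !(mpol_graft, mdel_graft) e1 e2.
have [-> ->] := mpol_path_tree y k.
rewrite -addnS (path_rec_add _ _ rX) pathpSS; ring.
Qed.

(** The difference is y^2 (X_(c+1) - X_c). The index c + 2 excludes adjacent centres, for which the
    corresponding difference can change sign. *)
Lemma spine_exchange k ks y c : 0 < y -> 
  pathp y 3 * spine_seq (k :: ks) y c.+2 < pathp y 2 * spine_seq (k :: ks) y c.+3.
Proof.
move=> y0; set X := spine_seq _ y; have rX : path_rec y X := spine_seq_rec _ y.
rewrite (rX c.+1) (rX c) /pathp /=.
have := spine_seq_lt k ks c y0; rewrite -/X => h.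
have : 0 < y ^+ 2 * (X c.+1 - X c) by rewrite mulr_gt0 ?exprn_gt0 ?subr_gt0.
nra.
Qed.

Lemma bispider_shorten k b l c q ks :
  mpol_lt (bispider (k.+2 :: b :: l) c.+1 (q :: ks))
    (bispider (1%N :: b :: l) (c.+1 + k.+1) (q :: ks)).
Proof.
move=> y y0; rewrite /bispider [node (_.+2 :: _)]/= [node (1%N :: _)]/=.
set t := Graft _ (path_tree b).
have rX := spine_seq_rec (q :: ks) y.
have e c' := spine_seqE (q :: ks) y c'.
rewrite (mpol_branch t k.+2 rX (e _).1 (e _).2) (mpol_branch t 1 rX (e _).1 (e _).2).
rewrite (_ : (c.+1 + k.+1 + 1 = c.+1 + k.+2)%N); last by lia.
rewrite ltrD2r ltr_pM2l ?subr_gt0 ?mdel_lt_mpol//.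
have := path_rec_exchange rX y0 (spine_exchange q ks c y0) k.
by rewrite !addSn; apply.
Qed.

Lemma bispider_lengthen b l c q ks :
  mpol_lt (bispider (0%N :: b :: l) c.+1 (q :: ks)) (bispider (1%N :: b :: l) c (q :: ks)).
Proof.
move=> y y0; rewrite /bispider [node (0%N :: _)]/= [node (1%N :: _)]/=.
set t := Graft _ (path_tree b).
have rX := spine_seq_rec (q :: ks) y.
have e c' := spine_seqE (q :: ks) y c'.
rewrite (mpol_branch t 0 rX (e _).1 (e _).2) (mpol_branch t 1 rX (e _).1 (e _).2).
rewrite addn0 addn1 ltrD2r ltr_pM2l ?subr_gt0 ?mdel_lt_mpol//.
rewrite rX /pathp /= mul1r mulr1 mulrDl mul1r ltrD2l ltr_pM2l//.
exact: spine_seq_lt.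
Qed.

(** Puts a pendent path into the last position, so that [mpol_branch] applies to two pendent paths
    of the same centre. *)
Lemma mpol_graftAC t a b s y :
  mpol (Graft (Graft (Graft t a) b) s) y = mpol (Graft (Graft (Graft t s) b) a) y.
Proof. by rewrite !(mpol_graft, mdel_graft); ring. Qed.

Lemma pathp_lt y n : 0 < y -> pathp y n.+1 < pathp y n.+2.
Proof. by move=> y0; rewrite pathpSS ltrDl mulr_gt0// (pathp_gt0 n y0).1. Qed.

(** For k = 1 the two sides coincide: an exchange with a P_2 only permutes the two paths. *)
Lemma pathp_exchange y k : k != 1%N -> 0 < y ->
  pathp y 3 * pathp y k.+1 < pathp y 2 * pathp y k.+2.
Proof.
case: k => [|[//|k]] _ y0; first by rewrite /pathp /=; nra.
rewrite (pathpSS y k.+2) (pathpSS y k.+1) [pathp y 2]/pathp [pathp y 3]/pathp /=.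
have := pathp_lt k y0 => h.
have : 0 < y ^+ 2 * (pathp y k.+2 - pathp y k.+1) by rewrite mulr_gt0 ?exprn_gt0 ?subr_gt0.
nra.
Qed.

Lemma bispider_balance k1 k2 l c ks : k2 != 1%N ->
  mpol_lt (bispider (k1.+2 :: k2 :: l) c ks) (bispider (1%N :: (k2 + k1.+1)%N :: l) c ks).
Proof.
move=> k21 y y0; rewrite /bispider [node (_.+2 :: _)]/= [node (1%N :: _)]/=
  (mpol_graftAC (node l) _ (path_tree k1.+2)) (mpol_graftAC (node l) _ (path_tree 1)).
set t := Graft _ (spine _ _).
have rX : path_rec y (pathp y) by move=> n; exact: pathpSS.
have e c' := mpol_path_tree y c'.
rewrite (mpol_branch t k1.+2 rX (e _).1 (e _).2) (mpol_branch t 1 rX (e _).1 (e _).2).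
rewrite (_ : (k2 + k1.+1 + 1 = k2 + k1.+2)%N); last by lia.
rewrite ltrD2r ltr_pM2l ?subr_gt0 ?mdel_lt_mpol//.
have := path_rec_exchange rX y0 (pathp_exchange k21 y0) k1.
by rewrite addSn.
Qed.

Lemma mpol_pendant t k y : mpol (Graft t (path_tree k)) y =
  mpol t y * pathp y k.+1 + y * (mdel t y * pathp y k).
Proof. by rewrite mpol_graft (mpol_path_tree y k).1 (mpol_path_tree y k).2. Qed.

Lemma mdel_pendant t k y : mdel (Graft t (path_tree k)) y = mdel t y * pathp y k.+1.
Proof. by rewrite mdel_graft (mpol_path_tree y k).1. Qed.

(** For a node, [mpol / mdel] is 1 plus y times the sum of P_q / P_(q+1) over its entries q, and
    this ratio has its least value 1 / (1 + y) at q = 1. *)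
Lemma mdel_mpol_ratio q1 q2 y : 0 < y ->
  mdel (node [:: q1; q2]) y * mpol (node [:: 1; 1]%N) y <=
  mpol (node [:: q1; q2]) y * mdel (node [:: 1; 1]%N) y.
Proof.
move=> y0; rewrite /node /foldr !mpol_pendant !mdel_pendant.
rewrite [mpol Root _]/mpol [mdel Root _]/mdel [pathp y 1]/pathp [pathp y 2]/pathp /=.
have h q : pathp y q.+1 <= (1 + y) * pathp y q.
  case: q => [|q]; first by rewrite /pathp /=; nra.
  by rewrite pathpSS mulrDl mul1r lerD2l ler_pM2l// pathp_le.
have := h q1; have := h q2.
have := (pathp_gt0 q1 y0).2; have := (pathp_gt0 q2 y0).2.
move: (pathp y q1) (pathp y q1.+1) (pathp y q2) (pathp y q2.+1) => a b c d d0 b0 hc ha.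
rewrite -subr_ge0 [X in 0 <= X](_ : _ = y * (1 + y) * (d * ((1 + y) * a - b) + b * ((1 + y) * c - d))).
  have y1 : 0 < 1 + y by rewrite addr_gt0.
  apply: mulr_ge0; first by rewrite mulr_ge0 ?ltW.
  by rewrite addr_ge0// mulr_ge0 ?subr_ge0// ltW.
ring.
Qed.

(** Adjacent centres leave no spine to draw on, so the vertex that completes a single leaf to P_2 is
    taken from the long path at the other centre. *)
Lemma bispider_cross q1 q2 j :
  mpol_lt (bispider [:: 0; q1; q2]%N 0 [:: j.+2; 1; 1]%N)
          (bispider [:: 1; q1; q2]%N 0 [:: j.+1; 1; 1]%N).
Proof.
move=> y y0; rewrite /bispider /spine /iter.
have N k l : node (k :: l) = Graft (node l) (path_tree k) by [].
rewrite (N 0%N) (N 1%N [:: q1; q2]) (N j.+2) (N j.+1).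
have hr := mdel_mpol_ratio q1 q2 y0.
have hL := mdel_lt_mpol (Graft Root (path_tree q2)) (path_tree q1) y0.
rewrite -[Graft _ (path_tree q1)]/(node [:: q1; q2]) in hL *.
move: (node [:: q1; q2]) hr hL => A hr hL.
have [R0 R0'] := mpol_gt0 (node [:: 1; 1]%N) y0.
move: (node [:: 1; 1]%N) hr R0 R0' => B hr R0 R0'.
rewrite (mpol_graft (Graft A _)) (mpol_graft (Graft A (path_tree 1))).
rewrite !(mpol_pendant A, mdel_pendant A, mpol_pendant B, mdel_pendant B).
rewrite [pathp y 0]/pathp [pathp y 1]/pathp [pathp y 2]/pathp /= !pathpSS.
have [p0 p1] := pathp_gt0 j y0; have pl := pathp_le j y0.
move: (pathp y j) (pathp y j.+1) p0 p1 pl => p p' p0 p1 pl.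
move: (mpol A y) (mdel A y) (mpol B y) (mdel B y) hr hL R0 R0' => L L' M M' hr hL R0 R0'.
rewrite -subr_gt0 [X in 0 < X](_ : _ = y ^+ 2 * ((L - L') * (p * M) + (p' - p) * (L * M' - L' * M))).
  rewrite mulr_gt0 ?exprn_gt0// ltr_pwDl//; first by rewrite !mulr_gt0 ?subr_gt0.
  by rewrite mulr_ge0 ?subr_ge0.
ring.
Qed.

Lemma bispider_merge a b :
  mpol_lt (bispider [:: a.+2; 1; 1]%N 0 [:: b.+2; 1; 1]%N)
          (bispider [:: 1; 1; 1]%N 0 [:: (b + a).+3; 1; 1]%N).
Proof.
move=> y y0; rewrite /bispider /spine /iter.
have N k : node [:: k; 1; 1]%N = Graft (node [:: 1; 1]%N) (path_tree k) by [].
rewrite !N.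
have hL := mdel_lt_mpol (Graft Root (path_tree 1)) (path_tree 1) y0.
rewrite -[Graft _ (path_tree 1)]/(node [:: 1; 1]%N) in hL.
have [R0 R0'] := mpol_gt0 (node [:: 1; 1]%N) y0.
move: (node [:: 1; 1]%N) hL R0 R0' => B hL R0 R0'.
rewrite !(mpol_graft (Graft B _)) !(mpol_pendant B, mdel_pendant B).
have e1 : pathp y (b + a).+3 = pathp y a.+1 * pathp y b.+2 + y * (pathp y a * pathp y b.+1).
  by rewrite -(pathp_add y a b.+1) addSn.
have e2 : pathp y (b + a).+4 = pathp y a.+1 * pathp y b.+3 + y * (pathp y a * pathp y b.+2).
  by rewrite -(pathp_add y a b.+2) !addSn.
rewrite e1 e2 [pathp y 1]/pathp [pathp y 2]/pathp /= !pathpSS.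
have [a0 a1] := pathp_gt0 a y0; have [b0 b1] := pathp_gt0 b y0.
move: (pathp y a) (pathp y a.+1) (pathp y b) (pathp y b.+1) a0 a1 b0 b1 => p p' q q' a0 a1 b0 b1.
move: (mpol B y) (mdel B y) hL R0 R0' => S S' hL R0 R0'.
rewrite -subr_gt0 [X in 0 < X](_ : _ = y ^+ 3 * p * q * S * (S - S')).
  by rewrite !mulr_gt0 ?exprn_gt0 ?subr_gt0.
ring.
Qed.

End Steps.

Local Close Scope ring_scope.

(** * Normal forms for adjacent and for non-adjacent centres *)

Section Extremal.
Variable R : realType.
Implicit Types (t s : rtree) (bs ks l : seq nat) (c : nat).

Definition same_unrooted t t' :=
  (forall (V : finType) (e : rel V), symmetric e ->
    forall r, realizes e t setT r -> exists r', realizes e t' setT r') /\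
  (forall y : R, mpol t y = mpol t' y).

Definition improves t t' := same_unrooted t t' \/ mpol_lt R t t'.

Lemma same_unrooted_refl t : same_unrooted t t.
Proof. by split=> // V e _ r; exists r. Qed.

Lemma same_unrooted_trans t t' t'' :
  same_unrooted t t' -> same_unrooted t' t'' -> same_unrooted t t''.
Proof.
move=> [h1 m1] [h2 m2]; split=> [V e se r H|y]; last by rewrite m1.
by have [r' H'] := h1 V e se r H; exact: h2 H'.
Qed.

Lemma same_improves t t' t'' : same_unrooted t t' -> improves t' t'' -> improves t t''.
Proof.
move=> h [h'|h']; first by left; exact: same_unrooted_trans h h'.
by right=> y y0; rewrite h.2; exact: h'.
Qed.

Lemma lt_improves t t' t'' : mpol_lt R t t' -> improves t' t'' -> improves t t''.
Proof.
move=> h h'; right=> y y0; case: h' => [[_ h']|h']; first by rewrite -h'; exact: h.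
exact: lt_trans (h y y0) (h' y y0).
Qed.

Lemma same_tree_unrooted t t' : same_tree R t t' -> same_unrooted t t'.
Proof.
move=> [h m]; split=> [V e se r H|y]; last exact: (m y).1.
by exists r; exact: h.
Qed.

Lemma same_unrooted_graftC t s : same_unrooted (Graft t s) (Graft s t).
Proof.
split=> [V e se r|y]; first exact: realizes_reroot.
by rewrite !mpol_graft mulrC [(mdel t y * _)%R]mulrC.
Qed.

(** The root walks along the spine, vertex by vertex, to the other centre. *)
Lemma bispiderC bs c ks : same_unrooted (bispider bs c ks) (bispider ks c bs).
Proof.
rewrite /bispider /spine; move: (node bs) (node ks) => A B.
elim: c A => [|c IH] A; first exact: same_unrooted_graftC.
rewrite iterS; apply: same_unrooted_trans (same_unrooted_graftC _ _) _.
apply: same_unrooted_trans (same_tree_unrooted (same_tree_swap _ _ _ _)) _.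
by rewrite iterSr; exact: IH.
Qed.

Lemma node_rem x l : x \in l -> same_tree R (node l) (node (x :: rem x l)).
Proof.
elim: l => // k l IH; rewrite inE [rem _ _]/=.
have [->|xk] := eqVneq k x; first by move=> _; exact: same_tree_refl.
move=> /= /IH h.
have := same_tree_graft h (same_tree_refl R (path_tree k)).
by move/same_tree_trans; apply; exact: same_tree_swap.
Qed.

Lemma node_rem2 x z l : x \in l -> z \in rem x l ->
  same_tree R (node l) (node [:: x, z & rem z (rem x l)]).
Proof.
move=> xl zl; apply: same_tree_trans (node_rem xl) _.
exact: same_tree_graft (node_rem zl) (same_tree_refl _ _).
Qed.

Lemma bispider_node bs bs' c ks : same_tree R (node bs) (node bs') ->
  same_unrooted (bispider bs c ks) (bispider bs' c ks).
Proof.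
by move=> h; apply/same_tree_unrooted/same_tree_graft => //; exact: same_tree_refl.
Qed.

Local Notation defect := (count (predC1 1%N)).

Lemma rem_size3 x bs : x \in bs -> size bs = 3 -> exists b1 b2,
  [/\ rem x bs = [:: b1; b2], (x + b1 + b2 = sumn bs)%N &
      (x != 1) + (b1 != 1) + (b2 != 1) = defect bs]%N.
Proof.
move=> xb sb; have := perm_to_rem xb; have := size_rem xb; rewrite sb.
case: (rem x bs) => [|b1 [|b2 []]]//= _ p; exists b1, b2; split=> //.
  by rewrite (perm_sumn p) /=; lia.
by rewrite (seq.permP p) /=; lia.
Qed.

Lemma all1_size3 bs : size bs = 3 -> defect bs = 0 -> bs = [:: 1; 1; 1].
Proof.
case: bs => [|a [|b [|c []]]]//= _.
by do 3!case: eqP => //= ->.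
Qed.

Lemma le1_size3 bs : size bs = 3 -> ~~ has (leq 2) bs -> (sumn bs + defect bs = 3)%N.
Proof.
case: bs => [|a [|b [|c []]]]//= _; rewrite !negb_or -!ltnNge => /and4P[].
by case: a => [|[]]//; case: b => [|[]]//; case: c => [|[]].
Qed.

(* [defect] counts the pendent paths other than P_2; each step lowers it. *)
Lemma bispider_long m n bs c ks : (defect bs + defect ks <= m)%N ->
  size bs = 3 -> size ks = 3 -> (0 < c)%N -> (2 < n)%N ->
  (sumn bs + sumn ks + c = n + 4)%N ->
  improves (bispider bs c ks) (bispider [:: 1; 1; 1]%N (n - 2) [:: 1; 1; 1]%N).
Proof.
elim: m bs c ks => [|m IH] bs c ks dm sb sk c0 n2 sn.
  have eb : defect bs = 0 by lia.
  have ek : defect ks = 0 by lia.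
  move: sn; rewrite (all1_size3 sb eb) (all1_size3 sk ek) /= => sn.
  by left; rewrite (_ : c = n - 2)%N; [exact: same_unrooted_refl|lia].
have key bs' ks' : size bs' = 3 -> size ks' = 3 ->
    (sumn bs' + sumn ks' + c = n + 4)%N -> (defect bs' + defect ks' <= m.+1)%N ->
    has (leq 2) bs' -> improves (bispider bs' c ks') (bispider [:: 1; 1; 1]%N (n - 2) [:: 1; 1; 1]%N).
  move=> sb' sk' sn' dm' /hasP[x xb x2].
  have [b1 [b2 [eb es ed]]] := rem_size3 xb sb'.
  have := bispider_node c ks' (node_rem xb); rewrite eb => /same_improves; apply.
  case: x x2 xb eb es ed => [|[|k]]// _ xb eb es ed; case: c c0 sn sn' => // c _ _ sn'.
  case: ks' sk' sn' dm' => // q ks' sk' sn' dm'.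
  apply: lt_improves (@bispider_shorten R k b1 [:: b2] c q ks') _.
  by apply: IH => //=; move: sn' dm'; rewrite /= -es -ed /=; lia.
have [hb|hb] := boolP (has (leq 2) bs); first exact: key.
have [hk|hk] := boolP (has (leq 2) ks).
  by apply: same_improves (bispiderC _ _ _) _; apply: key => //; lia.
(* Without long paths the entries sum to at most 6, and to at most 5 if one of them is 0. As n + 4
   >= 7, the spine can then give up a vertex without making the centres adjacent. *)
have lb := le1_size3 sb hb; have lk := le1_size3 sk hk.
have key0 bs' ks' : size bs' = 3 -> size ks' = 3 ->
    (sumn bs' + sumn ks' + c = n + 4)%N -> (defect bs' + defect ks' <= m.+1)%N ->
    (sumn bs' + defect bs' = 3)%N -> (sumn ks' + defect ks' = 3)%N ->
    0 \in bs' -> improves (bispider bs' c ks') (bispider [:: 1; 1; 1]%N (n - 2) [:: 1; 1; 1]%N).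
  move=> sb' sk' sn' dm' lb' lk' xb.
  have [b1 [b2 [eb es ed]]] := rem_size3 xb sb'.
  have := bispider_node c ks' (node_rem xb); rewrite eb => /same_improves; apply.
  case: c c0 sn sn' {key} => // c _ _ sn'; case: ks' sk' sn' dm' lk' => // q ks' sk' sn' dm' lk'.
  apply: lt_improves (@bispider_lengthen R b1 [:: b2] c q ks') _.
  by apply: IH => //=; move: sn' dm' lk' lb'; rewrite /= -es -ed /=; lia.
have [zb|zb] := boolP (0 \in bs); first exact: key0.
have [zk|zk] := boolP (0 \in ks).
  by apply: same_improves (bispiderC _ _ _) _; apply: key0 => //; lia.
apply: IH => //.
have d0 l : 0 \notin l -> ~~ has (leq 2) l -> defect l = 0%N.
  move=> z h; apply/eqP; rewrite -leqn0 leqNgt -has_count; apply/hasPn => x xl /=.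
  rewrite negbK; have := hasPn h x xl; case: x xl => [xl|[]]//.
  by rewrite xl in z.
by rewrite (d0 bs) // (d0 ks).
Qed.

(** After balancing, a centre with a long path carries two P_2's besides. Two long paths, one at
    each centre, are merged; a single one supplies the vertices that complete the leaves at the
    other centre. *)
Lemma bispider_short m n bs ks : (defect bs + defect ks <= m)%N ->
  size bs = 3 -> size ks = 3 -> (2 < n)%N -> (sumn bs + sumn ks = n + 4)%N ->
  improves (bispider bs 0 ks) (bispider [:: 1; 1; 1]%N 0 [:: n.-1; 1; 1]%N).
Proof.
elim: m bs ks => [|m IH] bs ks dm sb sk n2 sn.
  have eb : defect bs = 0 by lia.
  have ek : defect ks = 0 by lia.
  by move: sn; rewrite (all1_size3 sb eb) (all1_size3 sk ek) /=; lia.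
pose unbalanced l := has (fun x => (2 <= x)%N && has (predC1 1%N) (rem x l)) l.
have key bs' ks' : size bs' = 3 -> size ks' = 3 ->
    (sumn bs' + sumn ks' = n + 4)%N -> (defect bs' + defect ks' <= m.+1)%N ->
    unbalanced bs' -> improves (bispider bs' 0 ks') (bispider [:: 1; 1; 1]%N 0 [:: n.-1; 1; 1]%N).
  move=> sb' sk' sn' dm' /hasP[x xb /andP[x2 /hasP[z zb z1]]].
  have [b1 [b2 [eb es ed]]] := rem_size3 xb sb'.
  apply: same_improves (bispider_node 0 ks' (node_rem2 xb zb)) _.
  have [w [ew es' ed']] : exists w, [/\ rem z (rem x bs') = [:: w], (z + w = b1 + b2)%N &
     ((z != 1) + (w != 1) = (b1 != 1) + (b2 != 1))%N].
    move: zb; rewrite eb !inE /=; have [<- _|zb1 /=] := eqVneq b1 z; first by exists b2.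
    move=> /eqP <-; exists b1; rewrite eqxx; split=> //; lia.
  rewrite ew; case: x x2 xb zb eb es ed ew => [|[|k]]// _ xb zb eb es ed ew.
  apply: lt_improves (@bispider_balance R k z [:: w] 0 ks' z1) _.
  by apply: IH => //=; move: sn' dm' z1; rewrite /= -es -ed /=; case: (_ =P 1)%N; lia.
have [ub|ub] := boolP (unbalanced bs); first exact: key.
have [uk|uk] := boolP (unbalanced ks).
  by apply: same_improves (bispiderC _ _ _) _; apply: key => //; lia.
have bal l x : size l = 3 -> ~~ unbalanced l -> x \in l -> (2 <= x)%N ->
    same_tree R (node l) (node [:: x; 1; 1]%N) /\ (x + 2 = sumn l)%N.
  move=> sl ul xl x2; have [b1 [b2 [eb es ed]]] := rem_size3 xl sl.
  have := hasPn ul x xl; rewrite x2 eb /= orbF negb_or !negbK => /andP[/eqP b11 /eqP b21].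
  by split; [have := node_rem xl; rewrite eb b11 b21|rewrite -es b11 b21; lia].
have fin bs' ks' : size bs' = 3 -> size ks' = 3 -> (sumn bs' + sumn ks' = n + 4)%N ->
    (defect bs' + defect ks' <= m.+1)%N ->
    ~~ unbalanced bs' -> ~~ unbalanced ks' -> has (leq 2) ks' ->
    improves (bispider bs' 0 ks') (bispider [:: 1; 1; 1]%N 0 [:: n.-1; 1; 1]%N).
  move=> sb' sk' sn' dm' ub' uk' /hasP[x xk x2].
  have [ex xs] := bal ks' x sk' uk' xk x2.
  apply: same_improves (bispiderC _ _ _) _; apply: same_improves (bispider_node _ _ ex) _.
  apply: same_improves (bispiderC _ _ _) _.
  have [/hasP[a ab a2]|hb] := boolP (has (leq 2) bs').
    have [ea as_] := bal bs' a sb' ub' ab a2.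
    apply: same_improves (bispider_node _ _ ea) _.
    case: x a x2 a2 xs as_ {xk ex ab ea} => [|[|x]]// [|[|a]]// _ _ xs as_.
    right; rewrite (_ : n.-1 = (x + a).+3); first exact: bispider_merge.
    by lia.
  have lb := le1_size3 sb' hb.
  have [zb|zb] := boolP (0 \in bs'); last first.
    have e1 : defect bs' = 0%N.
      apply/eqP; rewrite -leqn0 leqNgt -has_count; apply/hasPn => z zl /=.
      rewrite negbK; have := hasPn hb z zl; case: z zl => [zl|[]]//.
      by rewrite zl in zb.
    move: sn'; rewrite (all1_size3 sb' e1) /= => sn'; left.
    by rewrite (_ : x = n.-1); [exact: same_unrooted_refl|lia].
  have [b1 [b2 [eb es ed]]] := rem_size3 zb sb'.
  apply: same_improves (bispider_node _ _ (node_rem zb)) _; rewrite eb.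
  have dk : (0 < defect ks')%N.
    by rewrite -has_count; apply/hasP; exists x => //=; case: x x2 {xk ex xs} => [|[]].
  case: x x2 xs {xk ex} => [|[|j]]// _ xs.
  apply: lt_improves (@bispider_cross R b1 b2 j) _.
  by apply: IH => //=; move: es ed dk dm' sn' xs; rewrite /=; case: (_ =P 1)%N; lia.
have [hk|hk] := boolP (has (leq 2) ks); first exact: fin.
have [hb|hb] := boolP (has (leq 2) bs).
  by apply: same_improves (bispiderC _ _ _) _; apply: fin => //; lia.
by have := le1_size3 sb hb; have := le1_size3 sk hk; lia.
Qed.

End Extremal.

(** * Comparison of the two candidates *)

Local Open Scope ring_scope.

Section Comparison.
Variable R : realType.
Implicit Types (y : R) (la lb : seq R).

(* T_b and T_a for [t = j + 3], without the factor [(1 + y)^3]; the difference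
   of the two changes sign at [y = 2] only. *)
Definition Tb_factor y j : R := pathp y j.+3 * (1 + 8 * y + 14 * y ^+ 2 + y ^+ 3)
  + y * (pathp y j.+2 * (1 + 5 * y + 4 * y ^+ 2)).

Definition Ta_factor y j : R := Tb_factor y j + 2 * y ^+ 3 * (y - 2) * pathp y j.

Lemma mpol_Tb y j : mpol (bispider [:: 1; 1; 1]%N 0 [:: j.+2; 1; 1]%N) y =
  (1 + y) ^+ 3 * Tb_factor y j.
Proof.
rewrite /bispider /spine /iter mpol_graft /node /foldr !(mpol_pendant, mdel_pendant).
rewrite [mpol Root _]/mpol [mdel Root _]/mdel [pathp y 1]/pathp [pathp y 2]/pathp /=.
by rewrite /Tb_factor; ring.
Qed.

Lemma mpol_Ta y j : mpol (bispider [:: 1; 1; 1]%N j.+1 [:: 1; 1; 1]%N) y =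
  (1 + y) ^+ 3 * Ta_factor y j.
Proof.
rewrite /bispider mpol_graft /spine; set B := node _.
have [-> ->] := mpol_iter_root y B j.
(* The difference of consecutive paths stands for y P_(j-1) and also makes sense for j = 0. *)
have -> : mpol (iter j (Graft Root) B) y =
    pathp y j * mpol B y + (pathp y j.+1 - pathp y j) * mdel B y.
  case: j => [|j]; first by rewrite /pathp /= subrr mul0r addr0 mul1r.
  by rewrite (mpol_iter_root y B j).1 pathpSS; ring.
rewrite /B /node /foldr !(mpol_pendant, mdel_pendant).
rewrite [mpol Root _]/mpol [mdel Root _]/mdel [pathp y 1]/pathp [pathp y 2]/pathp /=.
by rewrite /Ta_factor /Tb_factor !pathpSS; ring.
Qed.

Lemma Tb_factor_rec y : path_rec y (Tb_factor y).
Proof. by move=> j; rewrite /Tb_factor !pathpSS; ring. Qed.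

Lemma Tb_factor_gt0 y j : 0 < y -> 0 < Tb_factor y j.
Proof.
move=> y0; have [_ h1] := pathp_gt0 j.+2 y0; have [_ h2] := pathp_gt0 j.+1 y0.
by rewrite /Tb_factor !(addr_gt0, mulr_gt0, exprn_gt0).
Qed.

Lemma Ta_factor_gt0 y j : 0 < y -> 0 < Ta_factor y j.
Proof.
move=> y0; have := (mpol_gt0 (bispider [:: 1; 1; 1]%N j.+1 [:: 1; 1; 1]%N) y0).1.
by rewrite mpol_Ta pmulr_rgt0// exprn_gt0// addr_gt0.
Qed.

Lemma path_rec_le y (X Y : nat -> R) m : path_rec y X -> path_rec y Y -> 0 < y ->
  X m <= Y m -> X m.+1 <= Y m.+1 -> forall j, (m <= j)%N -> X j <= Y j.
Proof.
move=> rX rY y0 h0 h1 j mj.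
suff H k : X (m + k)%N <= Y (m + k)%N /\ X (m + k).+1 <= Y (m + k).+1.
  by have := (H (j - m)%N).1; rewrite subnKC.
elim: k => [|k [a b]]; first by rewrite addn0.
by rewrite addnS; split=> //; rewrite rX rY lerD// ler_pM2l.
Qed.

Lemma path_rec_scale y X c : path_rec y X -> path_rec y (fun j => c * X j).
Proof. by move=> rX j; rewrite rX; ring. Qed.

(** As T_a / T_b = 1 + 2 y^3 (y - 2) P_j / T_b, the extremes of P_j / T_b decide. Both sequences
    obey the same recurrence, so by [path_rec_le] this inequality makes the values at j = 3 and j =
    4 the least and the greatest for j >= 3. *)
Lemma Tb_ratio_base y : 0 < y -> pathp y 3 * Tb_factor y 4 <= pathp y 4 * Tb_factor y 3.
Proof.
move=> y0; rewrite /Tb_factor /pathp /= -subr_ge0.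
rewrite [X in 0 <= X](_ : _ = y ^+ 4 * (1 + 10 * y + 27 * y ^+ 2 + 19 * y ^+ 3 + y ^+ 4)); last by ring.
by rewrite mulr_ge0 ?exprn_ge0 ?addr_ge0 ?mulr_ge0 ?exprn_ge0 ?(ltW y0).
Qed.

Lemma Ta_ratio_large y j : 2 <= y -> (3 <= j)%N ->
  Tb_factor y j * Ta_factor y 3 <= Ta_factor y j * Tb_factor y 3.
Proof.
move=> y2 j3; have y0 : 0 < y by rewrite (lt_le_trans _ y2).
have h : pathp y 3 * Tb_factor y j <= Tb_factor y 3 * pathp y j.
  apply: (@path_rec_le y (fun j => pathp y 3 * Tb_factor y j)
    (fun j => Tb_factor y 3 * pathp y j) 3) j3 => //.
  - exact/path_rec_scale/Tb_factor_rec.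
  - by apply: path_rec_scale => n; exact: pathpSS.
  - by rewrite mulrC.
  - by rewrite [X in _ <= X]mulrC Tb_ratio_base.
rewrite /Ta_factor.
have c0 : 0 <= 2 * y ^+ 3 * (y - 2) by rewrite !mulr_ge0 ?exprn_ge0 ?subr_ge0 ?(ltW y0).
by have := ler_wpM2l c0 h; lra.
Qed.

Lemma Ta_ratio_small y j : 0 < y -> y <= 2 -> (3 <= j)%N ->
  Tb_factor y j * Ta_factor y 4 <= Ta_factor y j * Tb_factor y 4.
Proof.
move=> y0 y2 j3.
have h : Tb_factor y 4 * pathp y j <= pathp y 4 * Tb_factor y j.
  apply: (@path_rec_le y (fun j => Tb_factor y 4 * pathp y j)
    (fun j => pathp y 4 * Tb_factor y j) 3) j3 => //.
  - by apply: path_rec_scale => n; exact: pathpSS.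
  - exact/path_rec_scale/Tb_factor_rec.
  - by rewrite mulrC Tb_ratio_base.
  - by rewrite mulrC.
rewrite /Ta_factor.
have c0 : 0 <= 2 * y ^+ 3 * (2 - y) by rewrite !mulr_ge0 ?exprn_ge0 ?subr_ge0 ?(ltW y0).
by have := ler_wpM2l c0 h; lra.
Qed.

Lemma Ta_ratio_error y : 0 < y ->
  y <= 2 -> Tb_factor y 4 * Ta_factor y 3 <=
    Ta_factor y 4 * Tb_factor y 3 * (1 + y ^+ 2 / 1500).
Proof.
move=> y0 _; rewrite -subr_ge0 /Ta_factor /Tb_factor /pathp /=.
have h k : 0 < y ^+ k by rewrite exprn_gt0.
(* Once y^2 is factored out, the expansion has negative coefficients only at y^6 and y^7; the two
   squares absorb them. *)
have h4 : 0 <= y ^+ 4 * (1 - y ^+ 2) ^+ 2 by rewrite mulr_ge0 ?sqr_ge0 ?ltW.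
have h5 : 0 <= y ^+ 5 * (4 - 11 / 2 * y ^+ 2) ^+ 2 by rewrite mulr_ge0 ?sqr_ge0 ?ltW.
(* The product is T_a at j = 4 times T_b at j = 3; the subtracted term comes from the difference
   computed in [Tb_ratio_base]. *)
rewrite [X in 0 <= X](_ : _ = y ^+ 2 * (
  (1 + 15 * y + 82 * y ^+ 2 + 200 * y ^+ 3 + 219 * y ^+ 4 + 97 * y ^+ 5 + 10 * y ^+ 6) *
  (1 + 14 * y + 69 * y ^+ 2 + 147 * y ^+ 3 + 128 * y ^+ 4 + 32 * y ^+ 5 + y ^+ 6) / 1500
  - 2 * (2 - y) * y ^+ 5 * (1 + 10 * y + 27 * y ^+ 2 + 19 * y ^+ 3 + y ^+ 4))); last by field.
apply: mulr_ge0; first exact: ltW.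
have := h 2%N; have := h 3%N; have := h 4%N; have := h 5%N; have := h 6%N.
have := h 7%N; have := h 8%N; have := h 9%N; have := h 10%N; have := h 11%N; have := h 12%N.
lra.
Qed.

(* With [t = j + 3], the eigenvalues of T_a and T_b are 1 and -1, three times
   each, the numbers [+- a] for the negative reciprocals [- a^-2] of the roots
   of the factor above, and possibly 0. The lists round these [a] down or up. *)
Definition Ta0_lower : seq R := [:: 19 / 32; 1; 2; 19 / 8].

Definition Tb0_upper : seq R := [:: 7 / 16; 25 / 19; 26 / 15; 37 / 15].

Definition Tb1_lower : seq R :=
  [:: 24 / 113; 21 / 29; 203 / 136; 653 / 370; 301 / 122].

Definition Ta1_upper : seq R := [:: 24 / 119; 1; 1; 232 / 109; 240 / 103].

Definition Ta2_lower : seq R := [:: 21 / 46; 1; 56 / 43; 35 / 16; 99 / 43].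

Definition Tb2_upper : seq R := [:: 3 / 8; 1; 35 / 22; 218 / 121; 79 / 32].

Definition Ta3_lower : seq R :=
  [:: 29 / 165; 173 / 232; 1; 421 / 280; 566 / 255; 1431 / 626].

Definition Tb3_upper : seq R :=
  [:: 101 / 530; 270 / 463; 413 / 342; 186 / 113; 622 / 339; 1108 / 449].

Lemma Ta0_lower_ge0 : all (Num.le 0) Ta0_lower.
Proof. by rewrite /Ta0_lower /=; do ?[apply/andP; split] => //; lra. Qed.

Lemma Tb0_upper_ge0 : all (Num.le 0) Tb0_upper.
Proof. by rewrite /Tb0_upper /=; do ?[apply/andP; split] => //; lra. Qed.

Lemma Tb1_lower_ge0 : all (Num.le 0) Tb1_lower.
Proof. by rewrite /Tb1_lower /=; do ?[apply/andP; split] => //; lra. Qed.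

Lemma Ta1_upper_ge0 : all (Num.le 0) Ta1_upper.
Proof. by rewrite /Ta1_upper /=; do ?[apply/andP; split] => //; lra. Qed.

Lemma Ta2_lower_ge0 : all (Num.le 0) Ta2_lower.
Proof. by rewrite /Ta2_lower /=; do ?[apply/andP; split] => //; lra. Qed.

Lemma Tb2_upper_ge0 : all (Num.le 0) Tb2_upper.
Proof. by rewrite /Tb2_upper /=; do ?[apply/andP; split] => //; lra. Qed.

Lemma Ta3_lower_ge0 : all (Num.le 0) Ta3_lower.
Proof. by rewrite /Ta3_lower /=; do ?[apply/andP; split] => //; lra. Qed.

Lemma Tb3_upper_ge0 : all (Num.le 0) Tb3_upper.
Proof. by rewrite /Tb3_upper /=; do ?[apply/andP; split] => //; lra. Qed.

(** This comparison and the seven below hold coefficient by coefficient, so the positivity of the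
    powers of y suffices. *)
Lemma sqprod_Ta0_lower y : 0 < y -> sqprod Ta0_lower y <= Ta_factor y 0.
Proof.
move=> y0; rewrite /sqprod /Ta0_lower !big_cons big_nil /Ta_factor /Tb_factor /pathp /= -subr_ge0.
have := exprn_gt0 2 y0; have := exprn_gt0 3 y0; have := exprn_gt0 4 y0.
have := exprn_gt0 5 y0; have := exprn_gt0 6 y0; lra.
Qed.

Lemma sqprod_Tb0_upper y : 0 < y -> Tb_factor y 0 <= sqprod Tb0_upper y.
Proof.
move=> y0; rewrite /sqprod /Tb0_upper !big_cons big_nil /Ta_factor /Tb_factor /pathp /= -subr_ge0.
have := exprn_gt0 2 y0; have := exprn_gt0 3 y0; have := exprn_gt0 4 y0.
have := exprn_gt0 5 y0; have := exprn_gt0 6 y0; lra.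
Qed.

Lemma sqprod_Tb1_lower y : 0 < y -> sqprod Tb1_lower y <= Tb_factor y 1.
Proof.
move=> y0; rewrite /sqprod /Tb1_lower !big_cons big_nil /Ta_factor /Tb_factor /pathp /= -subr_ge0.
have := exprn_gt0 2 y0; have := exprn_gt0 3 y0; have := exprn_gt0 4 y0.
have := exprn_gt0 5 y0; have := exprn_gt0 6 y0; lra.
Qed.

Lemma sqprod_Ta1_upper y : 0 < y -> Ta_factor y 1 <= sqprod Ta1_upper y.
Proof.
move=> y0; rewrite /sqprod /Ta1_upper !big_cons big_nil /Ta_factor /Tb_factor /pathp /= -subr_ge0.
have := exprn_gt0 2 y0; have := exprn_gt0 3 y0; have := exprn_gt0 4 y0.
have := exprn_gt0 5 y0; have := exprn_gt0 6 y0; lra.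
Qed.

Lemma sqprod_Ta2_lower y : 0 < y -> sqprod Ta2_lower y <= Ta_factor y 2.
Proof.
move=> y0; rewrite /sqprod /Ta2_lower !big_cons big_nil /Ta_factor /Tb_factor /pathp /= -subr_ge0.
have := exprn_gt0 2 y0; have := exprn_gt0 3 y0; have := exprn_gt0 4 y0.
have := exprn_gt0 5 y0; have := exprn_gt0 6 y0; lra.
Qed.

Lemma sqprod_Tb2_upper y : 0 < y -> Tb_factor y 2 <= sqprod Tb2_upper y.
Proof.
move=> y0; rewrite /sqprod /Tb2_upper !big_cons big_nil /Ta_factor /Tb_factor /pathp /= -subr_ge0.
have := exprn_gt0 2 y0; have := exprn_gt0 3 y0; have := exprn_gt0 4 y0.
have := exprn_gt0 5 y0; have := exprn_gt0 6 y0; lra.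
Qed.

Lemma sqprod_Ta3_lower y : 0 < y -> sqprod Ta3_lower y <= Ta_factor y 3.
Proof.
move=> y0; rewrite /sqprod /Ta3_lower !big_cons big_nil /Ta_factor /Tb_factor /pathp /= -subr_ge0.
have := exprn_gt0 2 y0; have := exprn_gt0 3 y0; have := exprn_gt0 4 y0.
have := exprn_gt0 5 y0; have := exprn_gt0 6 y0; lra.
Qed.

Lemma sqprod_Tb3_upper y : 0 < y -> Tb_factor y 3 <= sqprod Tb3_upper y.
Proof.
move=> y0; rewrite /sqprod /Tb3_upper !big_cons big_nil /Ta_factor /Tb_factor /pathp /= -subr_ge0.
have := exprn_gt0 2 y0; have := exprn_gt0 3 y0; have := exprn_gt0 4 y0.
have := exprn_gt0 5 y0; have := exprn_gt0 6 y0; lra.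
Qed.

Lemma sqprod_nseq1 n y : sqprod (nseq n 1) y = (1 + y) ^+ n.
Proof.
elim: n => [|n IH]; first by rewrite /sqprod big_nil.
by rewrite exprS -IH /sqprod big_cons expr1n mul1r.
Qed.

(** Six ones account for (1 + y)^6, and [l] is taken twice because [f] is squared. *)
Lemma sum_lower l la (f : R -> R) : all (Num.le 0) l -> all (Num.le 0) la ->
  (forall y, 0 < y -> sqprod la y = ((1 + y) ^+ 3 * f y) ^+ 2) ->
  (forall y, 0 < y -> sqprod l y <= f y) ->
  6 + (\sum_(a <- l) a) *+ 2 <= \sum_(a <- la) a.
Proof.
move=> l0 la0 H Hl.
have -> : 6 + (\sum_(a <- l) a) *+ 2 = \sum_(a <- nseq 6 1 ++ l ++ l) a :> R.
  rewrite !big_cat /= !big_cons big_nil mulr2n; ring.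
apply: sqprod_sum_le => //; first by rewrite !all_cat l0 /= !ler01.
move=> y y0; rewrite !sqprod_cat sqprod_nseq1 H// exprMn -exprM -expr2.
have s0 : 0 <= sqprod l y by exact/ltW/sqprod_gt0/ltW.
have f0 : 0 <= f y := le_trans s0 (Hl y y0).
by rewrite ler_pM2l ?exprn_gt0 ?addr_gt0// ler_pXn2r ?nnegrE// Hl.
Qed.

Lemma sum_upper l la (f : R -> R) : all (Num.le 0) l -> all (Num.le 0) la ->
  (forall y, 0 < y -> sqprod la y = ((1 + y) ^+ 3 * f y) ^+ 2) ->
  (forall y, 0 < y -> 0 < f y) ->
  (forall y, 0 < y -> f y <= sqprod l y) ->
  \sum_(a <- la) a <= 6 + (\sum_(a <- l) a) *+ 2.
Proof.
move=> l0 la0 H f0 Hl.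
have -> : 6 + (\sum_(a <- l) a) *+ 2 = \sum_(a <- nseq 6 1 ++ l ++ l) a :> R.
  rewrite !big_cat /= !big_cons big_nil mulr2n; ring.
apply: sqprod_sum_le => //; first by rewrite !all_cat l0 /= !ler01.
move=> y y0; rewrite !sqprod_cat sqprod_nseq1 H// exprMn -exprM -expr2.
have s0 : 0 <= sqprod l y by exact/ltW/sqprod_gt0/ltW.
have fy0 : 0 <= f y := ltW (f0 y y0).
by rewrite ler_pM2l ?exprn_gt0 ?addr_gt0// ler_pXn2r ?nnegrE// Hl.
Qed.

(* As functions of [j >= 3] the ratios T_a/T_b are smallest at [j = 4] for
   [y <= 2] and at [j = 3] for [2 <= y]. Hence T_a/T_b is at least its value at
   [j = 3], up to a factor which is close to 1 and is only needed for
   [y <= 2 < (17/12)^2]; the gap between the two energies at [j = 3] outweighs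
   what this factor costs. *)
Lemma Ta_Tb_large la lb j : all (Num.le 0) la -> all (Num.le 0) lb -> (3 <= j)%N ->
  (forall y, 0 < y -> sqprod la y = ((1 + y) ^+ 3 * Ta_factor y j) ^+ 2) ->
  (forall y, 0 < y -> sqprod lb y = ((1 + y) ^+ 3 * Tb_factor y j) ^+ 2) ->
  \sum_(a <- lb) a < \sum_(a <- la) a.
Proof.
move=> la0 lb0 j3 Ha Hb.
pose ra := Ta3_lower; pose rb := Tb3_upper.
have ra0 : all (Num.le 0) ra := Ta3_lower_ge0.
have rb0 : all (Num.le 0) rb := Tb3_upper_ge0.
(* Appending the approximations for j = 3 crosswise turns the comparison of the ratios T_a / T_b at
   j and at 3 into one between two products. *)
have sq y : 0 < y -> sqprod (lb ++ ra ++ ra) y =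
    ((1 + y) ^+ 3 * (Tb_factor y j * sqprod ra y)) ^+ 2.
  by move=> y0; rewrite !sqprod_cat Hb// -expr2 -exprMn mulrA.
have sq' y : 0 < y -> sqprod (la ++ rb ++ rb) y =
    ((1 + y) ^+ 3 * (Ta_factor y j * sqprod rb y)) ^+ 2.
  by move=> y0; rewrite !sqprod_cat Ha// -expr2 -exprMn mulrA.
have cmp y (u v w : R) : 0 < y -> 0 <= u -> 0 <= v -> 0 <= w -> u <= v * w ->
    ((1 + y) ^+ 3 * u) ^+ 2 <= ((1 + y) ^+ 3 * v) ^+ 2 * w ^+ 2.
  move=> y0 u0 v0 w0 uvw.
  have c0 : 0 < (1 + y) ^+ 3 by rewrite exprn_gt0// addr_gt0.
  rewrite (_ : _ * w ^+ 2 = ((1 + y) ^+ 3 * (v * w)) ^+ 2); last by ring.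
  have h1 : 0 <= (1 + y) ^+ 3 * u by exact: mulr_ge0 (ltW c0) u0.
  have h2 : 0 <= (1 + y) ^+ 3 * (v * w) by exact: mulr_ge0 (ltW c0) (mulr_ge0 v0 w0).
  by rewrite ler_pXn2r ?nnegrE// ler_pM2l.
have ta0 y k : 0 < y -> 0 <= Ta_factor y k by move=> y0; exact/ltW/Ta_factor_gt0.
have tb0 y k : 0 < y -> 0 <= Tb_factor y k by move=> y0; exact/ltW/Tb_factor_gt0.
have s0 l y : 0 < y -> 0 <= sqprod l y by move=> y0; exact/ltW/sqprod_gt0/ltW.
have c0 : 0 < 17 / 12 :> R by rewrite divr_gt0.
(* For y <= 2 the square of 1 + y^2 / 1500 is at most 1 + y^2 / 600. *)
have K0 : 0 <= 600^-1 :> R by rewrite invr_ge0.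
have large y : 2 <= y -> sqprod (lb ++ ra ++ ra) y <= sqprod (la ++ rb ++ rb) y.
  move=> y2; have y0 : 0 < y by rewrite (lt_le_trans _ y2).
  rewrite sq// sq'// -[X in _ <= X]mulr1 -[X in _ <= _ * X](expr1n _ 2).
  apply: cmp; rewrite ?mulr_ge0 ?ta0 ?tb0 ?s0 // mulr1.
  apply: (@le_trans _ _ (Tb_factor y j * Ta_factor y 3)).
    by rewrite ler_wpM2l ?tb0// sqprod_Ta3_lower.
  apply: (le_trans (Ta_ratio_large y2 j3)).
  by rewrite ler_wpM2l ?ta0// sqprod_Tb3_upper.
have small y : 0 < y -> y <= 2 -> sqprod (lb ++ ra ++ ra) y <=
    sqprod (la ++ rb ++ rb) y * (1 + y ^+ 2 / 1500) ^+ 2.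
  move=> y0 y2; have w0 : 0 <= 1 + y ^+ 2 / 1500 by rewrite addr_ge0// divr_ge0// sqr_ge0.
  rewrite sq// sq'//; apply: cmp; rewrite ?mulr_ge0 ?ta0 ?tb0 ?s0 //.
  apply: (@le_trans _ _ (Tb_factor y j * Ta_factor y 3)).
    by rewrite ler_wpM2l ?tb0// sqprod_Ta3_lower.
  apply: (@le_trans _ _ (Ta_factor y j * Tb_factor y 3 * (1 + y ^+ 2 / 1500))).
    (* The comparison passes through j = 4, where the ratio is smallest in this range, so both sides
       are multiplied by T_a at j = 4. *)
    rewrite -(ler_pM2r (Ta_factor_gt0 4 y0)).
    apply: (@le_trans _ _ (Ta_factor y j * Tb_factor y 4 * Ta_factor y 3)).
      by rewrite mulrAC ler_wpM2r ?ta0// Ta_ratio_small.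
    have := ler_wpM2l (ta0 y j y0) (Ta_ratio_error y0 y2); lra.
  by rewrite ler_wpM2r// ler_wpM2l ?ta0// sqprod_Tb3_upper.
have := @sqprod_sum_err R (la ++ rb ++ rb) (lb ++ ra ++ ra) 600^-1 1 (17 / 12).
rewrite !all_cat la0 lb0 ra0 rb0 => /(_ isT isT c0 K0) H.
have {}H : - (600^-1 * (17 / 12) ^+ 3 / 3) <= pi *
    (\sum_(z <- la ++ rb ++ rb) z - \sum_(z <- lb ++ ra ++ ra) z) :> R.
  apply: H => y; last by move=> yc; apply: large; lra.
  move=> /andP[y0 yc]; have [y2|/ltW y2] := leP y 2; last first.
    apply: le_trans (large y y2) _.
    by rewrite ler_peMr ?s0// lerDl mulr_ge0 ?sqr_ge0.
  apply: le_trans (small y y0 y2) _; rewrite ler_wpM2l ?s0//.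
  have : y ^+ 2 <= 4 by nra.
  have := sqr_ge0 y; nra.
move: H; rewrite !big_cat /=.
set A := \sum_(i <- la) i; set B := \sum_(i <- lb) i.
rewrite /ra /rb /Ta3_lower /Tb3_upper !big_cons big_nil.
set S := (X in pi * X) => H; rewrite ltNge; apply/negP => AB.
(* Twice the gap between the sums of the rational lists exceeds 11 / 10000. Multiplied by pi >= 2
   this gives at least 0.0022, against an error term (17 / 12)^3 / 1800 < 0.0016. *)
have S0 : S <= - (11 / 10000) by rewrite /S; lra.
have := pi_ge2 R; nra.
Qed.

Lemma Ta_Tb_sum la lb j : all (Num.le 0) la -> all (Num.le 0) lb ->
  (forall y, 0 < y -> sqprod la y = mpol (bispider [:: 1; 1; 1]%N j.+1 [:: 1; 1; 1]%N) y ^+ 2) ->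
  (forall y, 0 < y -> sqprod lb y = mpol (bispider [:: 1; 1; 1]%N 0 [:: j.+2; 1; 1]%N) y ^+ 2) ->
  if j == 1%N then \sum_(a <- la) a < \sum_(a <- lb) a
  else \sum_(a <- lb) a < \sum_(a <- la) a.
Proof.
move=> la0 lb0 Ha Hb.
have {}Ha y : 0 < y -> sqprod la y = ((1 + y) ^+ 3 * Ta_factor y j) ^+ 2.
  by move/Ha ->; rewrite mpol_Ta.
have {}Hb y : 0 < y -> sqprod lb y = ((1 + y) ^+ 3 * Tb_factor y j) ^+ 2.
  by move/Hb ->; rewrite mpol_Tb.
have ta0 k y : 0 < y -> 0 < Ta_factor y k := @Ta_factor_gt0 y k.
have tb0 k y : 0 < y -> 0 < Tb_factor y k := @Tb_factor_gt0 y k.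
case: j Ha Hb => [|[|[|j]]] Ha Hb.
- have h1 := sum_lower Ta0_lower_ge0 la0 Ha sqprod_Ta0_lower.
  have h2 := sum_upper Tb0_upper_ge0 lb0 Hb (tb0 _) sqprod_Tb0_upper.
  apply: le_lt_trans h2 (lt_le_trans _ h1).
  rewrite /Ta0_lower /Tb0_upper !big_cons !big_nil; lra.
- have h1 := sum_lower Tb1_lower_ge0 lb0 Hb sqprod_Tb1_lower.
  have h2 := sum_upper Ta1_upper_ge0 la0 Ha (ta0 _) sqprod_Ta1_upper.
  apply: le_lt_trans h2 (lt_le_trans _ h1).
  rewrite /Tb1_lower /Ta1_upper !big_cons !big_nil; lra.
- have h1 := sum_lower Ta2_lower_ge0 la0 Ha sqprod_Ta2_lower.
  have h2 := sum_upper Tb2_upper_ge0 lb0 Hb (tb0 _) sqprod_Tb2_upper.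
  apply: le_lt_trans h2 (lt_le_trans _ h1).
  rewrite /Ta2_lower /Tb2_upper !big_cons !big_nil; lra.
exact: (@Ta_Tb_large la lb j.+3).
Qed.

End Comparison.

Local Close Scope ring_scope.

(** * Conclusion *)

Lemma path_P2_tree_Ta D t : 2 < t ->
  path_P2_tree (fun i => if (i == 0) || (i == t.-1) then D - 1 else 0) 0 t.-1 =
  Graft (pendants (D - 1)) (iter (t - 2) (Graft Root) (pendants (D - 1))).
Proof.
move=> t2; set c := fun i => _.
have H k i : 0 < i -> i + k = t.-1 -> path_P2_tree c i k = iter k (Graft Root) (pendants (D - 1)).
  elim: k i => [|k IH] i i0 ik /=; first by rewrite /c (_ : i = t.-1) ?eqxx ?orbT; [|lia].
  rewrite IH; [|lia|lia]; rewrite /c.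
  have -> : (i == 0) = false by lia.
  by have -> : (i == t.-1) = false by lia.
rewrite [in LHS](_ : t.-1 = (t - 2).+1); last by lia.
by rewrite [LHS]/= (H (t - 2)); [|lia|lia].
Qed.

Lemma path_P2_tree_Tb D t : 0 < t ->
  path_P2_tree (fun i => if i == 0 then D - 1 else if i == 1 then D - 2 else 0) 0 t.+1 =
  Graft (pendants (D - 1)) (Graft (pendants (D - 2)) (path_tree t.-1)).
Proof.
case: t => // t _; rewrite [LHS]/=; do 2!congr Graft.
have H k i : path_P2_tree (fun i => if i == 0 then D - 1 else if i == 1 then D - 2 else 0) i.+2 k
    = path_tree k by elim: k i => //= k IH i; rewrite IH.
exact: H.
Qed.

(** * The 2-branches of the two candidates *)

Section PathP2Degree.
Variables (m : nat) (c : nat -> nat).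
Local Notation V := (path_P2_vertex m c).
Local Notation E := (path_P2 m c).
Local Notation foot p := (inr (p, false) : V).
Local Notation tip p := (inr (p, true) : V).

Lemma degree_tip p : degree E (tip p) = 1.
Proof.
rewrite /degree (_ : [set y | _] = [set foot p]) ?cards1//; apply/setP => -[i|[q []]].
- by rewrite !inE; apply/esym/eqP.
- by rewrite !inE /path_P2 /=; apply/esym/eqP => -[].
by rewrite !inE /path_P2 /=; apply/eqP/eqP => [->|[->]].
Qed.

Lemma degree_foot p : degree E (foot p) = 2.
Proof.
rewrite /degree (_ : [set y | _] = [set inl (tag p); tip p]).
  by rewrite cards2.
apply/setP => -[i|[q []]]; rewrite !inE /path_P2 /=.
- by apply/eqP/orP => [->|[/eqP[->]|/eqP]]//; left.
- by rewrite orbF; apply/eqP/eqP => [->|[->]].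
by apply/esym/eqP => -[].
Qed.

Lemma two_branch_tip p : two_branch E (tip p).
Proof.
rewrite /two_branch degree_tip eqxx; apply/existsP; exists (foot p).
by rewrite degree_foot eqxx andbT /path_P2 /= eqxx.
Qed.

Lemma degree_end (i j : 'I_m) : i.+1 = j -> j.+1 = m -> c j = 0 ->
  degree E (inl j) = 1.
Proof.
move=> ij jm cj; rewrite /degree (_ : [set y | _] = [set inl i]) ?cards1//.
apply/setP => -[l|[q []]]; rewrite !inE /path_P2 /=.
- have -> : (l == j.+1 :> nat) = false by have := ltn_ord l; lia.
  by rewrite -ij eqSS eq_sym orFb.
- by apply/esym/eqP.
rewrite orbF; have -> : (inr (q, false) == inl i :> V) = false by apply/eqP.
by apply/eqP => tq; have := leq_ltn_trans (leq0n _) (ltn_ord (tagged q)); rewrite tq cj.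
Qed.

Lemma degree_middle (i j k : 'I_m) : i.+1 = j -> j.+1 = k -> c j = 0 ->
  degree E (inl j) = 2.
Proof.
move=> ij jk cj; rewrite /degree (_ : [set y | _] = [set inl i; inl k]).
  rewrite cards2; have -> // : inl i != inl k :> V.
  by apply/eqP => -[ik]; move: jk; rewrite -ij -ik; lia.
apply/setP => -[l|[q []]]; rewrite !inE /path_P2 /=.
- by rewrite jk -ij eqSS orbC [_ == l :> nat]eq_sym.
- by apply/esym/eqP.
rewrite orbF; have -> : (inr (q, false) == inl k :> V) = false by apply/eqP.
by apply/eqP => tq; have := leq_ltn_trans (leq0n _) (ltn_ord (tagged q)); rewrite tq cj.
Qed.

Lemma card_tagged_ord : #|{: {i : 'I_m & 'I_(c i)}}| = \sum_(i < m) c i.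
Proof.
rewrite card_tagged sumnE big_map big_enum /=.
by apply: eq_bigr => i _; rewrite card_ord.
Qed.

Definition tips : {set V} := [set tip p | p : {i : 'I_m & 'I_(c i)}].

Lemma card_tips : #|tips| = \sum_(i < m) c i.
Proof. by rewrite card_imset ?card_tagged_ord// => p q []. Qed.

Lemma num_two_branches_ge : \sum_(i < m) c i <= num_two_branches E.
Proof.
rewrite -card_tips; apply/subset_leq_card/subsetP => _ /imsetP[p _ ->].
by rewrite inE two_branch_tip.
Qed.

(** The free end of the path is a 2-branch that is not among the [tips]; it is the sixth one of
    T_b. *)
Lemma num_two_branches_end (h i j : 'I_m) : h.+1 = i -> i.+1 = j -> j.+1 = m ->
  c i = 0 -> c j = 0 -> \sum_(i < m) c i < num_two_branches E.
Proof.
move=> hi ij jm ci cj; have nj : inl j \notin tips by apply/imsetP => -[].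
rewrite -card_tips -add1n -[1](cards1 (inl j : V)).
have <- : #|[set inl j] :|: tips| = (#|[set inl j : V]| + #|tips|)%N.
  by rewrite -cardsUI (_ : _ :&: _ = set0) ?cards0 ?addn0//; apply/eqP; rewrite setI_eq0 disjoints1.
apply/subset_leq_card/subsetP => x; rewrite !inE.
move=> /orP[/eqP ->|/imsetP[p _ ->]]; last exact: two_branch_tip.
rewrite /two_branch (degree_end ij jm cj) eqxx; apply/existsP; exists (inl i).
by rewrite (degree_middle hi ij ci) eqxx andbT /path_P2 /= ij eqxx orbT.
Qed.

End PathP2Degree.

Lemma num_two_branches_Ta t : 2 < t -> 6 <= num_two_branches (Ta 4 t).
Proof.
move=> t2; apply: leq_trans (num_two_branches_ge _ _).
case: t t2 => [|[|t]]// _; rewrite big_ord_recl big_ord_recr /=.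
by rewrite eqxx; lia.
Qed.

Lemma num_two_branches_Tb t : 2 < t -> 6 <= num_two_branches (Tb 4 t).
Proof.
move=> t2; set c := fun i : nat => if i == 0 then 4 - 1 else if i == 1 then 4 - 2 else 0.
have l1 : t.-1 < t + 2 by lia.
have l2 : t < t + 2 by lia.
have l3 : t.+1 < t + 2 by lia.
have h : \sum_(i < t + 2) c i < num_two_branches (Tb 4 t).
  apply: (@num_two_branches_end (t + 2) c (Ordinal l1) (Ordinal l2) (Ordinal l3)) => /=.
  - by lia.
  - by [].
  - by lia.
  - by rewrite /c; case: t t2 {l1 l2 l3} => [|[|]].
  - by rewrite /c; case: t t2 {l1 l2 l3} => [|[|]].
apply: leq_trans h; rewrite ltnS.
rewrite (_ : \sum_(i < t + 2) c i = \sum_(i < t.+2) c i); last by rewrite addn2.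
by rewrite !big_ord_recl /c /=; lia.
Qed.

Lemma degree_iso (V W : finType) (e : rel V) (f : rel W) (h : V -> W) :
  bijective h -> (forall x y, f (h x) (h y) = e x y) ->
  forall x, degree f (h x) = degree e x.
Proof.
move=> hb he x; rewrite /degree -(card_imset _ (bij_inj hb)); congr #|pred_of_set _|.
apply/setP => z; rewrite inE; apply/idP/imsetP => [fz|[y]]; last by rewrite inE -he => fy ->.
have [g hg gh] := hb; exists (g z); last by rewrite gh.
by rewrite inE -he gh.
Qed.

Lemma num_two_branches_iso (V W : finType) (e : rel V) (f : rel W) :
  graph_iso e f -> num_two_branches f <= num_two_branches e.
Proof.
move=> [h hb he]; have dh := degree_iso hb he; have [g hg gh] := hb.
rewrite /num_two_branches -[X in _ <= X](card_imset _ (bij_inj hb)).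
apply/subset_leq_card/subsetP => z; rewrite inE => /andP[dz /existsP[w /andP[zw dw]]].
apply/imsetP; exists (g z); last by rewrite gh.
rewrite inE /two_branch -dh gh dz; apply/existsP; exists (g w).
by rewrite -he -dh !gh zw.
Qed.

Definition Ta_tree t : rtree := bispider [:: 1; 1; 1] (t - 2) [:: 1; 1; 1].
Definition Tb_tree t : rtree := bispider [:: 1; 1; 1] 0 [:: t.-1; 1; 1].

Lemma pendantsE k : pendants k = node (nseq k 1).
Proof. by elim: k => //= k ->. Qed.

Lemma realizes_Ta t : 2 < t -> exists r, realizes (Ta 4 t) (Ta_tree t) setT r.
Proof.
move=> t2; have [r] := @realizes_path_P2 t
  (fun i => if (i == 0) || (i == t.-1) then 4 - 1 else 0) t.-1 (esym (prednK (ltnW (ltnW t2)))).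
by rewrite path_P2_tree_Ta// !pendantsE; exists r.
Qed.

Lemma realizes_Tb t : 2 < t -> exists r, realizes (Tb 4 t) (Tb_tree t) setT r.
Proof.
move=> t2; have [r] := @realizes_path_P2 (t + 2)
  (fun i => if i == 0 then 4 - 1 else if i == 1 then 4 - 2 else 0) t.+1 (addn2 t).
by rewrite path_P2_tree_Tb ?(ltnW (ltnW t2))// !pendantsE; exists r.
Qed.

Lemma order_Ta_tree t : 2 < t -> order (Ta_tree t) = t + 12.
Proof. by move=> t2; rewrite /Ta_tree /bispider order_graft order_node order_spine /=; lia. Qed.

Lemma order_Tb_tree t : 2 < t -> order (Tb_tree t) = t + 12.
Proof. by move=> t2; rewrite /Tb_tree /bispider order_graft order_node order_spine /=; lia. Qed.

Lemma sum_branch_iter F n s : F 2 = 0 ->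
  sum_branch F (iter n (Graft Root) s) = sum_branch F s.
Proof.
by move=> F2; elim: n => // n <-; rewrite iterS /sum_branch /= F2 add0n addnC.
Qed.

Lemma sum_branch_path_tree F k : F 1 = 0 -> F 2 = 0 -> sum_branch F (path_tree k) = 0.
Proof.
move=> F1 F2; have -> : path_tree k = iter k (Graft Root) Root by elim: k => //= k ->.
by rewrite sum_branch_iter// /sum_branch /= F1.
Qed.

Lemma sum_degree_bispider F a b c c' q q1 q2 : F 1 = 0 -> F 2 = 0 ->
  sum_degree F (bispider [:: a; b; c] c' [:: q; q1; q2]) = F 4 + F 4.
Proof.
move=> F1 F2; rewrite /sum_degree /bispider /=.
have h k := sum_branch_path_tree k F1 F2.
have := sum_branch_iter c' (node [:: q; q1; q2]) F2.
rewrite -/(spine _ _) /sum_branch /=.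
move: (h a) (h b) (h c) (h q) (h q1) (h q2); rewrite /sum_branch; lia.
Qed.

Section Assembly.
Variable R : realType.

Lemma energy_lt (V W : finType) (e : rel V) (f : rel W) t t' r r' :
  simple_graph e -> simple_graph f ->
  realizes e t setT r -> realizes f t' setT r' -> mpol_lt R t t' ->
  (energy e R < energy f R)%R.
Proof.
move=> [se ie] [sf iF] He Hf lt_tt'.
have [l [l0 <- le]] := @energy_sqprod R _ _ _ _ se ie He.
have [l' [l0' <- le']] := @energy_sqprod R _ _ _ _ sf iF Hf.
apply: sqprod_sum_lt => // y y0; rewrite le// le'//.
have [m0 _] := mpol_gt0 t y0; have [m0' _] := mpol_gt0 t' y0.
by rewrite ltr_pXn2r ?nnegrE ?(ltW m0) ?(ltW m0')//; exact: lt_tt'.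
Qed.

Lemma energy_eq (V W : finType) (e : rel V) (f : rel W) t r r' :
  simple_graph e -> simple_graph f ->
  realizes e t setT r -> realizes f t setT r' -> energy e R = energy f R.
Proof.
move=> [se ie] [sf iF] He Hf.
have [l [l0 <- le]] := @energy_sqprod R _ _ _ _ se ie He.
have [l' [l0' <- le']] := @energy_sqprod R _ _ _ _ sf iF Hf.
by apply/eqP; rewrite eq_le; apply/andP; split; apply: sqprod_sum_le => // y y0; rewrite le// le'.
Qed.

Lemma simple_path_P2 m c : simple_graph (path_P2 m c).
Proof. by split; [exact: path_P2_sym|exact: path_P2_irr]. Qed.

Lemma energy_Ta_Tb t : 2 < t ->
  if t == 4 then (energy (Ta 4 t) R < energy (Tb 4 t) R)%R
  else (energy (Tb 4 t) R < energy (Ta 4 t) R)%R.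
Proof.
move=> t2; have [ra Ha] := realizes_Ta t2; have [rb Hb] := realizes_Tb t2.
have [la [la0 <- lae]] := @energy_sqprod R _ _ _ _ (@path_P2_sym _ _) (@path_P2_irr _ _) Ha.
have [lb [lb0 <- lbe]] := @energy_sqprod R _ _ _ _ (@path_P2_sym _ _) (@path_P2_irr _ _) Hb.
case: t t2 lae lbe {Ha Hb ra rb} => [|[|[|j]]]// _ lae lbe.
apply: (@Ta_Tb_sum R la lb j la0 lb0) => y y0; last exact: lbe.
by rewrite lae// /Ta_tree subSS subSS subn0.
Qed.

Lemma two_max_tree_simple (V : finType) (e : rel V) n D : two_max_tree e n D -> simple_graph e.
Proof. by case=> [[]]. Qed.

(** The root is placed at a vertex of degree 4, so that [below_bispider] applies; whether the
    centres of the resulting bispider are adjacent decides between the candidates. *)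
Lemma two_max_tree_cases (V : finType) (e : rel V) t : 2 < t ->
  two_max_tree e (t + 12) 4 -> exists T r, realizes e T setT r /\
    (improves R T (Ta_tree t) \/ improves R T (Tb_tree t)).
Proof.
move=> t2 He; have [se ie] := two_max_tree_simple He.
have [[_ _ conn acyc] _ _ card2] := He.
have /card_gt0P[u] : 0 < #|[set x | degree e x == 4]| by rewrite card2.
rewrite inE => /eqP du; have [T HT] := tree_realizes se ie acyc u conn.
exists T, u; split=> //.
have [oT s5 s4] := (two_max_treeP se ie (t + 12) HT).1 He.
have nT : nchild T = 4 by rewrite -(degree_root se ie HT).
rewrite /sum_degree nT /= in s5 s4.
have [||bs [c [ks [sb sk ob bT]]]] := @below_bispider R T nT.
- by move: s5; lia.
- by move: s4; lia.
have imp T' : improves R (bispider bs c ks) T' -> improves R T T'.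
  case: bT => [bT|bT]; first exact: same_improves (same_tree_unrooted bT).
  exact: lt_improves.
have sum : sumn bs + sumn ks + c = t + 4.
  by move: ob; rewrite oT /bispider order_graft order_node order_spine sb sk; lia.
case: c sum imp {ob bT} => [|c] sum imp; [right|left]; apply: imp.
  by apply: (@bispider_short R _ t) (leqnn _) _ _ _ _ => //; lia.
by apply: (@bispider_long R _ t) (leqnn _) _ _ _ _ _ => //; lia.
Qed.

Lemma two_max_tree_bound (V : finType) (e : rel V) t : 2 < t ->
  two_max_tree e (t + 12) 4 ->
  [\/ exists r, realizes e (Ta_tree t) setT r, exists r, realizes e (Tb_tree t) setT r |
      (energy e R < energy (Ta 4 t) R)%R \/ (energy e R < energy (Tb 4 t) R)%R].
Proof.
move=> t2 He; have se := two_max_tree_simple He.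
have [T [r [HT iT]]] := two_max_tree_cases t2 He.
have [ra Ha] := realizes_Ta t2; have [rb Hb] := realizes_Tb t2.
case: iT => [[[h _]|h]|[[h _]|h]].
- by apply: Or31; exact: h se.1 _ HT.
- by apply: Or33; left; exact: energy_lt (simple_path_P2 _ _) HT Ha h.
- by apply: Or32; exact: h se.1 _ HT.
- by apply: Or33; right; exact: energy_lt (simple_path_P2 _ _) HT Hb h.
Qed.

Lemma iso_simple (V W : finType) (e : rel V) (f : rel W) :
  graph_iso e f -> simple_graph f -> simple_graph e.
Proof. by move=> [h _ he] [sf iF]; split=> [x y|x]; rewrite -!he ?iF// sf. Qed.

Lemma iso_realizes (V W : finType) (e : rel V) (f : rel W) T :
  graph_iso e f -> (exists r, realizes f T setT r) -> exists r, realizes e T setT r.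
Proof.
move=> [h hb he] [r' H]; have [g hg gh] := hb; exists (g r').
by rewrite -(preimsetT h); apply: (realizes_pull hb he); rewrite gh.
Qed.

Lemma realizes_two_max (V : finType) (e : rel V) t r T : simple_graph e ->
  2 < t -> T = Ta_tree t \/ T = Tb_tree t -> realizes e T setT r ->
  two_max_tree e (t + 12) 4.
Proof.
move=> [se ie] t2 HT H; apply/(two_max_treeP se ie _ H).
case: HT => ->; rewrite ?order_Ta_tree ?order_Tb_tree//.
  by rewrite /Ta_tree !sum_degree_bispider.
by rewrite /Tb_tree !sum_degree_bispider.
Qed.

(** Bound the number of leaves. Without vertices of degree 3, every degree d satisfies [d = 1] + d
    <= 2 + 2 [d = 4]; the degrees sum to twice the number of edges, so summation leaves at most 6
    leaves. *)
Lemma num_two_branches_le (V : finType) (e : rel V) t : 2 < t ->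
  two_max_tree e (t + 12) 4 -> branching_at_max_only e -> num_two_branches e <= 6.
Proof.
move=> t2 He hb; have [se ie] := two_max_tree_simple He.
have [T [r [HT _]]] := two_max_tree_cases t2 He.
have [oT _ s4] := (two_max_treeP se ie (t + 12) HT).1 He.
have [_ _ max4 _] := He.
have hs : sum_degree id T = (2 * (t + 12 - 1))%N.
  rewrite -oT /order /= subn1 /= /sum_degree.
  have gen s : sum_nonroot id s + nchild s = (2 * sum_nonroot (fun=> 1) s)%N.
    by elim: s => //= s1 h1 s2 h2; lia.
  by rewrite -gen addnC.
have : num_two_branches e <= \sum_x (degree e x == 1).
  rewrite /num_two_branches -sum1dep_card big_mkcond; apply: leq_sum => x _.
  by rewrite /two_branch; case: (degree e x == 1); case: [exists y, _].
move/leq_trans; apply.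
have pw : \sum_x ((degree e x == 1) + degree e x) <=
    \sum_x (2 + ((4 == degree e x) + (4 == degree e x))).
  apply: leq_sum => x _; have := hb x; rewrite max4.
  have : degree e x <= 4 by rewrite -max4 /max_degree leq_bigmax.
  by case: (degree e x) => [|[|[|[|[|]]]]]//= _ /(_ isT).
move: pw; rewrite !big_split /=.
rewrite (sum_degreeP se ie id HT) hs (sum_degreeP se ie (eq_op 4) HT) s4.
by rewrite sum_nat_const (realizes_card se ie HT) oT; lia.
Qed.

Lemma branching_at_max (V : finType) (e : rel V) t r T : simple_graph e ->
  2 < t -> T = Ta_tree t \/ T = Tb_tree t -> realizes e T setT r ->
  branching_at_max_only e.
Proof.
move=> se t2 HT H; have [_ _ max4 _] := realizes_two_max se t2 HT H.
move=> x; rewrite max4 => dx.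
have d4 : degree e x <= 4 by rewrite -max4 /max_degree leq_bigmax.
have : \sum_x (degree e x == 3) = 0.
  rewrite (sum_degreeP se.1 se.2 (fun d => d == 3) H).
  by case: HT => ->; rewrite !sum_degree_bispider.
move/eqP; rewrite sum_nat_eq0 => /forallP/(_ x)/implyP/(_ isT).
by move: d4 dx; case: (degree e x) => [|[|[|[|[|]]]]].
Qed.

(** A reduction that does not preserve the tree raises the energy strictly, so a maximal tree
    realizes one of the two encodings, and [energy_Ta_Tb] rules out one of them. *)
Lemma max_energy_iff t (V : finType) (e : rel V) : 2 < t ->
  max_energy_tree R (t + 12) 4 e <->
  (if t == 4 then graph_iso e (Tb 4 t) else graph_iso e (Ta 4 t)).
Proof.
move=> t2; have [ra Ha] := realizes_Ta t2; have [rb Hb] := realizes_Tb t2.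
have sa : simple_graph (Ta 4 t) := simple_path_P2 _ _.
have sb : simple_graph (Tb 4 t) := simple_path_P2 _ _.
have ca := realizes_two_max sa t2 (or_introl erefl) Ha.
have cb := realizes_two_max sb t2 (or_intror erefl) Hb.
have eab := energy_Ta_Tb t2.
split=> [[He maxe]|iso].
  have se := two_max_tree_simple He.
  have ma := maxe _ _ ca; have mb := maxe _ _ cb.
  case: (two_max_tree_bound t2 He) => [[r H]|[r H]|].
  - have ee := energy_eq se sa H Ha; move: eab mb; rewrite ee.
    case: ifP => _ => [/lt_geF ->//|_ _].
    exact: (realizes_iso se.1 se.2 sa.1 sa.2 H Ha).
  - have ee := energy_eq se sb H Hb; move: eab ma; rewrite ee.
    case: ifP => _ => [_ _|/lt_geF ->//].
    exact: (realizes_iso se.1 se.2 sb.1 sb.2 H Hb).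
  - by case=> /lt_geF h; [rewrite h in ma|rewrite h in mb].
have bound (W : finType) (f : rel W) (M : R) : (energy (Ta 4 t) R <= M)%R ->
   (energy (Tb 4 t) R <= M)%R -> two_max_tree f (t + 12) 4 -> (energy f R <= M)%R.
  move=> ha hb Hf; have sf := two_max_tree_simple Hf.
  case: (two_max_tree_bound t2 Hf) => [[r H]|[r H]|].
  - by rewrite (energy_eq sf sa H Ha).
  - by rewrite (energy_eq sf sb H Hb).
  - by case=> /ltW h; [exact: le_trans h ha|exact: le_trans h hb].
move: eab iso; case: ifP => _ eab iso.
  have se := iso_simple iso sb.
  have [r H] := iso_realizes iso (realizes_Tb t2).
  split=> [|W f]; first exact: realizes_two_max se t2 (or_intror erefl) H.
  by apply: bound; rewrite (energy_eq se sb H Hb)// ltW.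
have se := iso_simple iso sa.
have [r H] := iso_realizes iso (realizes_Ta t2).
split=> [|W f]; first exact: realizes_two_max se t2 (or_introl erefl) H.
by apply: bound; rewrite (energy_eq se sa H Ha)// ltW.
Qed.

Lemma max_energy_two_branches t (V : finType) (e : rel V) : 2 < t ->
  max_energy_tree R (t + 12) 4 e -> most_two_branches (t + 12) 4 e.
Proof.
move=> t2 /(max_energy_iff _ t2) iso.
suff [f_ge six] : branching_at_max_only e /\ 6 <= num_two_branches e.
  split=> // W f Hf hb; apply: leq_trans six; exact: num_two_branches_le Hf hb.
move: iso; case: ifP => _ iso; split.
- have [r H] := iso_realizes iso (realizes_Tb t2).
  exact: branching_at_max (iso_simple iso (simple_path_P2 _ _)) t2 (or_intror erefl) H.
- exact: leq_trans (num_two_branches_Tb t2) (num_two_branches_iso iso).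
- have [r H] := iso_realizes iso (realizes_Ta t2).
  exact: branching_at_max (iso_simple iso (simple_path_P2 _ _)) t2 (or_introl erefl) H.
- exact: leq_trans (num_two_branches_Ta t2) (num_two_branches_iso iso).
Qed.

End Assembly.

Theorem theorem3p6 (R : realType) (n t : nat)
    (hnt : (t + 4 * 4 = n + 4)%N) (ht : (3 <= t)%N)
    (V : finType) (e : rel V) :
  (max_energy_tree R n 4 e -> most_two_branches n 4 e) /\
  (max_energy_tree R n 4 e <->
   (if t == 4%N then graph_iso e (Tb 4 t) else graph_iso e (Ta 4 t))).
Proof.
have -> : n = t + 12 by lia.
by split; [exact: max_energy_two_branches|exact: max_energy_iff].
Qed.
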